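(* (Twisted Schrödinger–Lichnerowicz formula.) Let $M$ be an oriented $n$-dimensional Riemannian manifold with a $Spin^r(n)$ structure ($r\ge 2$), with auxiliary rank $r$ oriented Riemannian bundle $F$ endowed with a metric connection $\nabla^F$, and let $m\in\mathbb N$ be such that $S=S(TM)\otimes S(F)^{\otimes m}$ is globally defined. Then for every $\phi\in\Gamma(S)$, $$D^\theta(D^\theta(\phi))=\Delta^\theta(\phi)+\frac{\mathrm R}{4}\phi+\frac12\tilde\Theta^m\cdot\phi,$$ where $\mathrm R$ is the scalar curvature of $M$.
   Context: Clifford algebra: $Cl_n$ is generated by an orthonormal basis $e_1,\dots,e_n$ of $\mathbb R^n$ with $e_ie_j+e_je_i=-2\delta_{ij}$; $\Delta_n=\mathbb C^{2^{[n/2]}}$ is the complex spinor space, on which $Cl_n$ acts via $\kappa$ (the isomorphism $Cl_n\otimes\mathbb C\cong\mathrm{End}(\Delta_n)$ for $n$ even; for $n$ odd the isomorphism with $\mathrm{End}(\Delta_n)\oplus\mathrm{End}(\Delta_n)$ followed by the projection to the first summand). Clifford multiplication is $x\cdot\phi=\kappa(x)\phi$; $X\wedge Y$ acts as $X\cdot Y+\langle X,Y\rangle$. $Spin(n)\subset Cl_n$ has Lie algebra spanned by $e_ie_j$, $i<j$; $\lambda_n:Spin(n)\to SO(n)$ is the double cover, with $\lambda_{n*}(e_ie_j)=2E_{ij}$, $E_{ij}:e_i\mapsto e_j,\ e_j\mapsto -e_i$. $\kappa^m_r$ is the representation of $Spin(r)$ on $\Delta_r^{\otimes m}$, and $\kappa^m_{r*}(f_kf_l)$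 is the sum over $a=1,\dots,m$ of Clifford multiplication by $f_kf_l$ in the $a$-th factor. On $\Delta_n\otimes\Delta_r^{\otimes m}$, vectors and forms of $\mathbb R^n$ act on $\Delta_n$ and $\kappa^m_{r*}(f_kf_l)$ acts on $\Delta_r^{\otimes m}$. $Spin^r(n)=(Spin(n)\times Spin(r))/\{\pm(1,1)\}$. A $Spin^r(n)$ structure on $M$ is a principal $SO(r)$-bundle $P_{SO(r)}$ and a principal $Spin^r(n)$-bundle $P$ with a 2:1 covering $P\to P_{SO(M)}\tilde\times P_{SO(r)}$ (fibered product) equivariant with respect to $\lambda_n\times\lambda_r$. $F$ is the rank $r$ vector bundle associated to $P_{SO(r)}$, and $S=S(TM)\otimes S(F)^{\otimes m}$ is the bundle with fiber $\Delta_n\otimes\Delta_r^{\otimes m}$ associated to $\kappa_n\otimes\kappa_r^m$; it is globally defined if $m$ is odd (structure group $Spin^r(n)$), or if $M$ and $F$ are both Spin (group $Spin(n)\times Spin(r)$, any $m$), or if $M$ is Spin and $m$ is even (group $Spin(n)\times SO(r)$). $\nabla^\theta$ is the covariant derivative on $S$ induced by the Levi-Civita connection and $\nabla^F$. For local orthonormal frames $(e_i)$ of $TM$ and $(f_k)$ of $F$: the twisted Dirac operator is $D^\theta\phi=\sum_ie_i\cdot\nabla^\theta_{e_i}\phi$ (written with a slashed partial in the paper); the connection Laplacian is $\Delta^\theta\phi=-\sum_i\nabla^\theta_{e_i}\nabla^\theta_{e_i}\phi-\sum_i\mathrm{div}(e_i)\nabla^\theta_{e_i}\phi$; $\Theta_{kl}(X,Y)=\langle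 R^F(X,Y)f_k,f_l\rangle$ with $R^F(X,Y)=[\nabla^F_X,\nabla^F_Y]-\nabla^F_{[X,Y]}$; and $\tilde\Theta^m\cdot\phi=\sum_{k<l}\sum_{i<j}\Theta_{kl}(e_i,e_j)\,e_ie_j\cdot\kappa^m_{r*}(f_kf_l)\cdot\phi$. *)

(* Defs.v *)
From HB Require Import structures.
From mathcomp Require Import all_boot all_order all_algebra complex mxtens.
From mathcomp Require Import all_classical all_reals all_analysis.
From mathcomp Require Import ring.
Set Implicit Arguments.
Unset Strict Implicit.
Unset Printing Implicit Defensive.
Import Order.TTheory GRing.Theory Num.Theory numFieldNormedType.Exports.
Local Open Scope classical_set_scope.
Local Open Scope ring_scope.
Local Open Scope complex_scope.

Local Notation "A *t B" := (tensmx A B) (at level 40, left associativity).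
Local Notation "A ^t k" := (ntensmx A k).


Definition symdiff (n : nat) (A B : {set 'I_n}) : {set 'I_n} :=
  [set i | (i \in A) (+) (i \in B)]%SET.

(* [clifford K n] is the Clifford algebra of [K ^ n] with [e_i e_i = -1], in
   its basis [e_A := e_(a_1) ... e_(a_k)], [A = {a_1 < ... < a_k}].  One has
   [e_A e_B = s(A, B) e_(A symdiff B)]: each pair [(a, b)] in [A x B] costs a
   sign when [b < a] (anticommutation) and when [a = b] ([e_a e_a = -1]).
   [clifford R n] is Cl_n and [clifford R[i] n] its complexification. *)
Definition clifford (K : comNzRingType) (n : nat) := {ffun {set 'I_n} -> K}.

Section CliffordAlgebra.
Variables (K : comNzRingType) (n : nat).
Local Notation Cl := (clifford K n).
Implicit Types (A B C : {set 'I_n}) (x y z : Cl).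

HB.instance Definition _ := GRing.Lmodule.copy Cl {ffun {set 'I_n} -> K^o}.

Definition clifford_sign A B : K :=
  \prod_i \prod_j (-1) ^+ [&& i \in A, j \in B & (j <= i)%N].

Definition clifford_basis A : Cl := [ffun B => (B == A)%:R].

Definition clifford_mul x y : Cl :=
  [ffun C => \sum_A x A * y (symdiff A C) * clifford_sign A (symdiff A C)].

Let symdiffA : associative (@symdiff n).
Proof. by move=> A B C; apply/setP => i; rewrite !inE addbA. Qed.

Let symdiffK A : involutive (symdiff A).
Proof. by move=> B; apply/setP => i; rewrite !inE addbA addbb addFb. Qed.

Let symdiffC : commutative (@symdiff n).
Proof. by move=> A B; apply/setP => i; rewrite !inE addbC. Qed.

Let sign_symdiffl A B C :
  clifford_sign (symdiff A B) C = clifford_sign A C * clifford_sign B C.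
Proof.
rewrite /clifford_sign -big_split; apply: eq_bigr => i _ /=.
rewrite -big_split; apply: eq_bigr => j _ /=; rewrite inE.
rewrite -signr_addb; congr (_ ^+ nat_of_bool _).
by case: (i \in A); case: (i \in B); rewrite ?addbF ?addbb.
Qed.

Let sign_symdiffr A B C :
  clifford_sign A (symdiff B C) = clifford_sign A B * clifford_sign A C.
Proof.
rewrite /clifford_sign -big_split; apply: eq_bigr => i _ /=.
rewrite -big_split; apply: eq_bigr => j _ /=; rewrite inE.
rewrite -signr_addb; congr (_ ^+ nat_of_bool _).
by case: (i \in A); case: (j \in B); case: (j \in C); case: (j <= i)%N.
Qed.

Let sign0l A : clifford_sign finset.set0 A = 1.
Proof. by rewrite /clifford_sign !big1 // => i _; rewrite big1 // => j _; rewrite inE. Qed.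

Let sign0r A : clifford_sign A finset.set0 = 1.
Proof. by rewrite /clifford_sign !big1 // => i _; rewrite big1 // => j _; rewrite !inE andbF. Qed.

Let symdiff0 A : symdiff finset.set0 A = A.
Proof. by apply/setP => i; rewrite !inE addFb. Qed.

Let clifford_mulA : associative clifford_mul.
Proof.
move=> x y z; apply/ffunP => C; rewrite !ffunE.
under eq_bigr => A _ do rewrite ffunE mulr_sumr mulr_suml.
under [RHS]eq_bigr => B _ do rewrite ffunE !mulr_suml.
rewrite [RHS]exchange_big /=; apply: eq_bigr => A _.
rewrite (reindex_inj (inv_inj (symdiffK A))) /=; apply: eq_bigr => B _.
have -> : symdiff (symdiff A B) (symdiff A C) = symdiff B C.
  by rewrite symdiffC symdiffA [symdiff (symdiff A C) A]symdiffC symdiffK symdiffC.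
have s2 : clifford_sign A C * clifford_sign A C = 1.
  rewrite -sign_symdiffr; have -> : symdiff C C = finset.set0.
    by apply/setP => i; rewrite !inE addbb.
  exact: sign0r.
rewrite sign_symdiffl; set d := clifford_sign B _; rewrite !sign_symdiffr.
by rewrite -[RHS]mulr1 -[in RHS]s2; ring.
Qed.

Let clifford_mul1l : left_id (clifford_basis finset.set0) clifford_mul.
Proof.
move=> x; apply/ffunP => C; rewrite !ffunE (bigD1 finset.set0) //= big1 => [|A nA].
  by rewrite ffunE eqxx mul1r symdiff0 sign0l mulr1 addr0.
by rewrite ffunE (negPf nA) !mul0r.
Qed.

Let clifford_mul1r : right_id (clifford_basis finset.set0) clifford_mul.
Proof.
move=> x; apply/ffunP => C; rewrite !ffunE (bigD1 C) //= big1 => [|A nA].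
  have -> : symdiff C C = finset.set0 by apply/setP => i; rewrite !inE addbb.
  by rewrite ffunE eqxx mulr1 sign0r mulr1 addr0.
rewrite ffunE; case: eqP => [AC|]; last by rewrite mulr0 mul0r.
by case/eqP: nA; rewrite -[C](symdiffK A) AC symdiffC symdiff0.
Qed.

Let clifford_mulDl : left_distributive clifford_mul +%R.
Proof.
move=> x y z; apply/ffunP => C; rewrite !ffunE -big_split; apply: eq_bigr => A _.
by rewrite ffunE !mulrDl.
Qed.

Let clifford_mulDr : right_distributive clifford_mul +%R.
Proof.
move=> x y z; apply/ffunP => C; rewrite !ffunE -big_split; apply: eq_bigr => A _.
by rewrite ffunE mulrDr mulrDl.
Qed.

Let clifford_1_neq0 : clifford_basis finset.set0 != 0.
Proof.
apply/eqP => /ffunP/(_ finset.set0); rewrite !ffunE eqxx.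
exact/eqP/oner_neq0.
Qed.

HB.instance Definition _ := GRing.Zmodule_isNzRing.Build Cl clifford_mulA
  clifford_mul1l clifford_mul1r clifford_mulDl clifford_mulDr clifford_1_neq0.

Let scale_ffunE (a : K) x A : (a *: x) A = a * x A.
Proof. by rewrite ffunE. Qed.

Let clifford_scalerAl (a : K) x y : a *: (x * y) = (a *: x) * y.
Proof.
apply/ffunP => C; rewrite scale_ffunE !ffunE mulr_sumr; apply: eq_bigr => A _.
by rewrite scale_ffunE !mulrA.
Qed.

Let clifford_scalerAr (a : K) x y : a *: (x * y) = x * (a *: y).
Proof.
apply/ffunP => C; rewrite scale_ffunE !ffunE mulr_sumr; apply: eq_bigr => A _.
by rewrite scale_ffunE; ring.
Qed.

HB.instance Definition _ := GRing.Lmodule_isLalgebra.Build K Cl clifford_scalerAl.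
HB.instance Definition _ := GRing.Lalgebra_isAlgebra.Build K Cl clifford_scalerAr.

Definition clifford_gen (i : 'I_n) : Cl := clifford_basis [set i]%SET.

Definition clifford_vec (v : 'rV[K]_n) : Cl := \sum_i v 0 i *: clifford_gen i.

Lemma clifford_basis_mul A B :
  clifford_basis A * clifford_basis B =
  clifford_sign A B *: clifford_basis (symdiff A B).
Proof.
apply/ffunP => C; rewrite scale_ffunE !ffunE (bigD1 A) //= big1 => [|D nD].
  rewrite !ffunE eqxx mul1r addr0.
  have -> : (symdiff A C == B) = (C == symdiff A B).
    by apply/eqP/eqP => [<-|->]; rewrite symdiffK.
  by case: eqP => [->|_]; rewrite ?symdiffK ?mulr1 ?mul1r ?mulr0 ?mul0r.
by rewrite ffunE (negPf nD) !mul0r.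
Qed.

Lemma clifford_gen_rel (i j : 'I_n) :
  clifford_gen i * clifford_gen j + clifford_gen j * clifford_gen i =
  - (2 * (i == j)%:R)%:A.
Proof.
have sgnE k l : clifford_sign [set k]%SET [set l]%SET = (-1) ^+ (l <= k)%N.
  rewrite /clifford_sign (bigD1 k) //= (bigD1 l) //= !big1 => [|k' nk|l' nl].
  - by rewrite !inE !eqxx !mulr1.
  - by rewrite big1 // => l' _; rewrite !inE (negPf nk).
  - by rewrite !inE (negPf nl) andbF.
rewrite /clifford_gen !clifford_basis_mul !sgnE symdiffC -scalerDl.
have [->|nij] := eqVneq i j.
  have -> : symdiff [set j]%SET [set j]%SET = finset.set0.
    by apply/setP => k; rewrite !inE addbb.
  by rewrite leqnn expr1 -opprD mulr1 scaleNr.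
rewrite mulr0 scale0r oppr0; case: (ltngtP i j) nij => [_|_|/val_inj->] /= nij.
- by rewrite expr0 expr1 subrr scale0r.
- by rewrite expr0 expr1 addNr scale0r.
- by rewrite eqxx in nij.
Qed.

(* Reversion, the anti-automorphism fixing every [e_i]; on the group [spin]
   below it is the inverse. *)
Definition clifford_rev (x : Cl) : Cl :=
  [ffun A : {set 'I_n} => (-1) ^+ 'C(#|A|, 2) * x A].

End CliffordAlgebra.

Section Spin.
Variables (R : realType) (n : nat).

Definition spin : set (clifford R n) :=
  [set g | exists s : seq 'rV[R]_n,
     [/\ ~~ odd (size s), all (fun v : 'rV[R]_n => \sum_i v 0 i ^+ 2 == 1) s &
         g = \prod_(v <- s) clifford_vec v]].

(* The matrix of [x |-> g x g^-1], for [g] in [spin]. *)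
Definition spin_cover (g : clifford R n) : 'M[R]_n :=
  \matrix_(i, j) (g * clifford_gen R j * clifford_rev g) [set i]%SET.

Definition complexify (x : clifford R n) : clifford R[i] n :=
  [ffun A => (x A)%:C].

Definition clifford_rep := {lrmorphism clifford R[i] n -> 'M[R[i]]_(2 ^ n./2)}.

Definition spinor_rep (kappa : clifford_rep) : Prop :=
  if odd n then
    exists kappa' : clifford_rep, bijective (fun x => (kappa x, kappa' x))
  else bijective kappa.

End Spin.

(* The action of a Lie algebra element on the [m]-th tensor power, i.e. the sum
   over [a < m] of [1 *t .. *t B *t .. *t 1] with [B] in the [a]-th factor. *)
Fixpoint dtensmx (K : comNzRingType) (d : nat) (B : 'M[K]_d) (m : nat) :
    'M[K]_(d ^ m) :=
  match m return 'M[K]_(d ^ m) with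
  | 0 => 0
  | m1.+1 =>
    match m1 return 'M[K]_(d ^ m1) -> 'M[K]_(d ^ m1.+1) with
    | 0 => fun=> B
    | m2.+1 => fun B' => B *t (1%:M : 'M[K]_(d ^ m2.+1)) + (1%:M : 'M[K]_d) *t B'
    end (dtensmx B m1)
  end.

Section Smooth.
Variables (R : realType) (n : nat).

Fixpoint Ck_on (k : nat) (U : set 'rV[R]_n) (h : 'rV[R]_n -> R) : Prop :=
  if k is k'.+1 then
    (forall z, U z -> differentiable h z) /\
    (forall j, Ck_on k' U (fun z => 'D_(delta_mx 0 j) h z))
  else forall z, U z -> {for z, continuous h}.

Definition Cinf_on (U : set 'rV[R]_n) (h : 'rV[R]_n -> R) : Prop :=
  forall k, Ck_on k U h.

Variable M : topologicalType.

(* [coord c] and [param c] are only meaningful on [dom c] and on its image. *)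
Record atlas := Atlas {
  chart : Type;
  dom : chart -> set M;
  coord : chart -> M -> 'rV[R]_n;
  param : chart -> 'rV[R]_n -> M }.

Variable A : atlas.
Implicit Types (c : chart A) (x y : M) (f h : M -> R).

Definition chart_image c (W : set M) : set 'rV[R]_n :=
  coord c @` (W `&` dom c).

Definition transition c c' (j : 'I_n) (z : 'rV[R]_n) : R :=
  coord c' (param c z) 0 j.

Record oriented_manifold : Prop := OrientedManifold {
  manifold_hausdorff : hausdorff_space M;
  manifold_second_countable : @second_countable M;
  dom_cover : forall x, exists c, dom c x;
  dom_open : forall c, open (dom c);
  image_open : forall c, open (chart_image c setT);
  coordK : forall c x, dom c x -> param c (coord c x) = x;
  coord_continuous : forall c x, dom c x -> {for x, continuous (coord c)};
  param_continuous : forall c z,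
    chart_image c setT z -> {for z, continuous (param c)};
  transition_smooth : forall c c' j,
    Cinf_on (chart_image c (dom c')) (transition c c' j);
  transition_oriented : forall c c' z, chart_image c (dom c') z ->
    0 < \det (\matrix_(i, j) 'D_(delta_mx 0 i) (transition c c' j) z) }.

Definition smooth_near x f : Prop :=
  exists W : set M, [/\ open W, W x &
    forall c, Cinf_on (chart_image c W) (f \o param c)].

(* Tangent vectors are derivations at [x]; the last clause makes a derivation
   determined by its values on the functions smooth near [x]. *)
Record derivation_at x (v : (M -> R) -> R) : Prop := DerivationAt {
  derivation_linear : forall a f h, smooth_near x f -> smooth_near x h ->
    v (fun y => a * f y + h y) = a * v f + v h;
  derivation_leibniz : forall f h, smooth_near x f -> smooth_near x h ->
    v (fun y => f y * h y) = v f * h x + f x * v h;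
  derivation_junk : forall f, ~ smooth_near x f -> v f = 0 }.

Definition tangent_pred x : {pred (M -> R) -> R} :=
  fun v => `[< derivation_at x v >].

Fact tangent_submod x : submod_closed (tangent_pred x).
Proof.
split=> [|a u v /asboolP[uD uL uJ] /asboolP[vD vL vJ]]; apply/asboolP; split.
- by move=> a f h _ _; rewrite mulr0 addr0.
- by move=> f h _ _; rewrite mul0r mulr0 addr0.
- by [].
- by move=> b f h sf sh; rewrite !fctE uD // vD //; rewrite /GRing.scale /=; ring.
- by move=> f h sf sh; rewrite !fctE uL // vL //; rewrite /GRing.scale /=; ring.
- by move=> f nf; rewrite !fctE uJ // vJ // scaler0 addr0.
Qed.

HB.instance Definition _ x :=
  GRing.isSubmodClosed.Build R ((M -> R) -> R) (tangent_pred x) (tangent_submod x).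

Record tangent x := Tangent {
  tangent_val :> (M -> R) -> R;
  tangentP : tangent_val \in tangent_pred x }.

HB.instance Definition _ x := [isSub for @tangent_val x].
HB.instance Definition _ x := [Choice of tangent x by <:].
HB.instance Definition _ x := [SubChoice_isSubLmodule of tangent x by <:].

Definition vector_field := forall x, tangent x.

(* For [X] and [Y] smooth near [x] the operator below is a derivation at [x],
   so that the default value [0] of [insubd] is not used. *)
Definition lie_bracket (X Y : vector_field) x : tangent x :=
  insubd (0 : tangent x) (fun f : M -> R =>
    if `[< smooth_near x f >]
    then X x (fun y => Y y f) - Y x (fun y => X y f) else 0).

(* [smooth_section x s] means that [s] is smooth on a neighbourhood of [x]. *)
Record vbundle (k : nat) := VBundle {
  fiber :> M -> lmodType R;
  inner : forall x, fiber x -> fiber x -> R;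
  smooth_section : M -> (forall y, fiber y) -> Prop;
  positive_basis : forall x, ('I_k -> fiber x) -> Prop }.

Definition orthonormal_basis k (E : vbundle k) x (e : 'I_k -> E x) : Prop :=
  (forall i j, inner (e i) (e j) = (i == j)%:R) /\
  (forall v, v = \sum_i inner v (e i) *: e i).

Definition oriented_frame k (E : vbundle k) x (e : 'I_k -> E x) : Prop :=
  orthonormal_basis e /\ positive_basis e.

Definition frame_act k (E : vbundle k) x (e : 'I_k -> E x) (O : 'M[R]_k) :
    'I_k -> E x :=
  fun j => \sum_i O i j *: e i.

Record inner_product_axioms k (E : vbundle k) : Prop := InnerProductAxioms {
  inner_sym : forall x (u v : E x), inner u v = inner v u;
  inner_linear : forall x a (u v w : E x),
    inner (a *: u + v) w = a * inner u w + inner v w;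
  inner_posdef : forall x (u : E x), u != 0 -> 0 < inner u u }.

Record oriented_riemannian_bundle k (E : vbundle k) : Prop :=
  OrientedRiemannianBundle {
  bundle_inner : inner_product_axioms E;
  bundle_orientation : forall x (e : 'I_k -> E x) (O : 'M[R]_k),
    orthonormal_basis e -> O *m O^T = 1%:M ->
    positive_basis (frame_act e O) <->
    (if 0 < \det O then positive_basis e else ~ positive_basis e);
  bundle_trivial : forall x, exists e : forall y, 'I_k -> E y,
    \forall z \near x, oriented_frame (e z) /\
      forall s : forall y, E y, smooth_section z s <->
        forall i, smooth_near z (fun y => inner (s y) (e y i)) }.

Definition tangent_bundle (g : forall x, tangent x -> tangent x -> R) :
    vbundle n := {|
  fiber := tangent;
  inner := g;
  smooth_section := fun x X =>
    \forall y \near x, forall f, smooth_near y f ->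
      smooth_near y (fun z => X z f);
  positive_basis := fun x e => forall c, dom c x ->
    0 < \det (\matrix_(i, j) e i (fun y => coord c y 0 j)) |}.

Record riemannian_metric (g : forall x, tangent x -> tangent x -> R) : Prop :=
  RiemannianMetric {
  metric_inner : inner_product_axioms (tangent_bundle g);
  metric_smooth : forall x (X Y : vector_field),
    smooth_section (v := tangent_bundle g) x X ->
    smooth_section (v := tangent_bundle g) x Y ->
    smooth_near x (fun y => g y (X y) (Y y)) }.

Definition connection k (E : vbundle k) :=
  forall x, tangent x -> (forall y, E y) -> E x.

Section Connection.
Variables (g : forall x, tangent x -> tangent x -> R).
Variables (k : nat) (E : vbundle k) (nabla : connection E).
Local Notation TM := (tangent_bundle g).
Implicit Types s t : forall y, E y.

Record metric_connection : Prop := MetricConnection {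
  connection_tensorial : forall x a (u v : tangent x) s, smooth_section x s ->
    nabla (a *: u + v) s = a *: nabla u s + nabla v s;
  connection_additive : forall x (v : tangent x) s t,
    smooth_section x s -> smooth_section x t ->
    nabla v (fun y => s y + t y) = nabla v s + nabla v t;
  connection_leibniz : forall x (v : tangent x) f s,
    smooth_near x f -> smooth_section x s ->
    nabla v (fun y => f y *: s y) = v f *: s x + f x *: nabla v s;
  connection_smooth : forall x (X : vector_field) s,
    smooth_section (v := TM) x X -> smooth_section x s ->
    smooth_section x (fun y => nabla (X y) s);
  connection_metric : forall x (v : tangent x) s t,
    smooth_section x s -> smooth_section x t ->
    v (fun y => inner (s y) (t y)) =
      inner (nabla v s) (t x) + inner (s x) (nabla v t) }.

Definition curvature x (X Y : vector_field) s : E x :=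
  nabla (X x) (fun y => nabla (Y y) s) - nabla (Y x) (fun y => nabla (X y) s)
  - nabla (lie_bracket X Y x) s.

End Connection.

Definition levi_civita (g : forall x, tangent x -> tangent x -> R)
    (nabla : connection (tangent_bundle g)) : Prop :=
  metric_connection g nabla /\
  forall x (X Y : vector_field),
    smooth_section (v := tangent_bundle g) x X ->
    smooth_section (v := tangent_bundle g) x Y ->
    nabla x (X x) Y - nabla x (Y x) X = lie_bracket X Y x.

End Smooth.

(* The structure groups are the quotients of [Spin(n) * Spin(r)] by the kernels
   below: Spin^r(n), Spin(n) * Spin(r) and Spin(n) * SO(r). *)
Variant structure_group := SpinR | SpinSpin | SpinSO.

Definition in_kernel (R : realType) (n r : nat) (G : structure_group)
    (a : clifford R n) (b : clifford R r) : Prop :=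
  match G with
  | SpinR => (a = 1 /\ b = 1) \/ (a = -1 /\ b = -1)
  | SpinSpin => a = 1 /\ b = 1
  | SpinSO => a = 1 /\ (b = 1 \/ b = -1)
  end.

Section SpinStructure.
Variables (R : realType) (n r : nat) (M : topologicalType) (A : atlas R n M).
Variables (g : forall x, tangent A x -> tangent A x -> R) (F : vbundle R M r).
Local Notation TM := (tangent_bundle g).

Definition smooth_spin_pair (x : M)
    (a : M -> clifford R n) (b : M -> clifford R r) : Prop :=
  [/\ \forall y \near x, spin (a y) /\ spin (b y),
      forall I, smooth_near A x (fun y => a y I) &
      forall J, smooth_near A x (fun y => b y J)].

(* A principal bundle with a map to the fibered product of the bundles of
   oriented orthonormal frames of [TM] and [F].  Its smooth structure is
   given by its smooth local sections: [smooth_gauge x s] means that [s] is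
   smooth on a neighbourhood of [x].  The structure group acts through
   [Spin(n) * Spin(r)]. *)
Record frame_lift := FrameLift {
  torsor :> M -> Type;
  act : forall x, torsor x -> clifford R n -> clifford R r -> torsor x;
  frameT : forall x, torsor x -> 'I_n -> tangent A x;
  frameF : forall x, torsor x -> 'I_r -> F x;
  smooth_gauge : M -> (forall y, torsor y) -> Prop }.

Record lifted_structure (G : structure_group) (P : frame_lift) : Prop :=
  LiftedStructure {
  act1 : forall x (p : P x), act p 1 1 = p;
  actM : forall x (p : P x) a b a' b', spin a -> spin b -> spin a' -> spin b' ->
    act (act p a b) a' b' = act p (a * a') (b * b');
  act_transitive : forall x (p q : P x),
    exists a b, [/\ spin a, spin b & q = act p a b];
  act_stabilizer : forall x (p : P x) a b, spin a -> spin b ->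
    act p a b = p <-> in_kernel G a b;
  gauge_exists : forall x, exists s, smooth_gauge (f := P) x s;
  gauge_open : forall x (s : forall y, P y), smooth_gauge x s ->
    \forall y \near x, smooth_gauge y s;
  gauge_change : forall x (s t : forall y, P y), smooth_gauge x s ->
    smooth_gauge x t <-> exists a b, smooth_spin_pair x a b /\
      \forall y \near x, t y = act (s y) (a y) (b y);
  frames_oriented : forall x (p : P x),
    oriented_frame (E := TM) (frameT p) /\ oriented_frame (frameF p);
  frames_equivariant : forall x (p : P x) a b, spin a -> spin b ->
    frameT (act p a b) = frame_act (E := TM) (frameT p) (spin_cover a) /\
    frameF (act p a b) = frame_act (frameF p) (spin_cover b);
  frames_onto : forall x (e : 'I_n -> tangent A x) (f : 'I_r -> F x),
    oriented_frame (E := TM) e -> oriented_frame f ->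
    exists p : P x, frameT p = e /\ frameF p = f;
  frames_fiber : forall x (p q : P x),
    frameT p = frameT q -> frameF p = frameF q ->
    exists a b : bool, q = act p ((-1) ^+ a) ((-1) ^+ b);
  frames_smooth : forall x (s : forall y, P y), smooth_gauge x s ->
    (forall i, smooth_section (v := TM) x (fun y => frameT (s y) i)) /\
    (forall k, smooth_section x (fun y => frameF (s y) k)) }.

(* [P] is a principal bundle to which [S] is associated: the given Spin^r(n)
   structure [P0] if [m] is odd, the one given by spin structures on [M] and
   [F], or, if [m] is even, the one given by a spin structure on [M]. *)
Definition globally_defined (m : nat) (P0 P : frame_lift) : Prop :=
  [\/ odd m /\ P = P0, lifted_structure SpinSpin P
    | ~~ odd m /\ lifted_structure SpinSO P].

Section Spinors.
Variables (m : nat) (kappan : clifford_rep R n) (kappar : clifford_rep R r).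
Variables (nablaM : connection A TM) (nablaF : connection A F) (P : frame_lift).

Definition spinor := 'cV[R[i]]_(2 ^ n./2 * (2 ^ r./2) ^ m).

Definition spin_act (a : clifford R n) (b : clifford R r) (u : spinor) : spinor :=
  (kappan (complexify a) *t (kappar (complexify b) ^t m)) *m u.

Definition clifford_act (a : clifford R n) (u : spinor) : spinor :=
  (kappan (complexify a) *t 1%:M) *m u.

Definition twist_act (b : clifford R r) (u : spinor) : spinor :=
  (1%:M *t dtensmx (kappar (complexify b)) m) *m u.

(* Sections of the associated bundle [P *_G spinor] are the equivariant maps. *)
Record spinor_section (phi : forall x, P x -> spinor) : Prop := SpinorSection {
  section_equivariant : forall x (p : P x) a b, spin a -> spin b ->
    spin_act a b (phi x (act p a b)) = phi x p;
  section_smooth : forall x (s : forall y, P y), smooth_gauge x s -> forall c,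
    smooth_near A x (fun y => complex.Re (phi y (s y) c 0)) /\
    smooth_near A x (fun y => complex.Im (phi y (s y) c 0)) }.

(* Differential operators on [S] act on the family of the representatives of a
   section in all gauges [s]; the representative in the gauge [s] is only
   meaningful where [s] is smooth. *)
Definition gauge_field := (forall y, P y) -> M -> spinor.

Definition representatives (phi : forall x, P x -> spinor) : gauge_field :=
  fun s y => phi y (s y).

Definition spinor_derivative x (v : tangent A x) (psi : M -> spinor) : spinor :=
  \col_c (v (fun y => complex.Re (psi y c 0)) +i*
          v (fun y => complex.Im (psi y c 0)))%C.

Definition connection_form k (E : vbundle R M k) (nabla : connection A E)
    (e : forall y, 'I_k -> E y) x (v : tangent A x) (i j : 'I_k) : R :=
  inner (nabla x v (fun y => e y i)) (e x j).

(* The so(n)-valued form [sum_(i < j) w_ij E_ij] lifts to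
   [1/2 sum_(i < j) w_ij e_i e_j] in the Lie algebra of Spin(n). *)
Definition nabla_theta (s : forall y, P y) x (v : tangent A x)
    (psi : M -> spinor) : spinor :=
  spinor_derivative v psi
  + \sum_(i < n) \sum_(j < n | (i < j)%N)
      (connection_form nablaM (fun y => frameT (s y)) v i j / 2)%:C *:
      clifford_act (clifford_gen R i * clifford_gen R j) (psi x)
  + \sum_(k < r) \sum_(l < r | (k < l)%N)
      (connection_form nablaF (fun y => frameF (s y)) v k l / 2)%:C *:
      twist_act (clifford_gen R k * clifford_gen R l) (psi x).

Definition twisted_dirac (Psi : gauge_field) : gauge_field := fun s x =>
  \sum_i clifford_act (clifford_gen R i) (nabla_theta s (frameT (s x) i) (Psi s)).

Definition divergence (e : forall y, 'I_n -> tangent A y)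
    (X : vector_field A) x : R :=
  \sum_j g (nablaM (e x j) X) (e x j).

Definition connection_laplacian (Psi : gauge_field) : gauge_field := fun s x =>
  let e y := frameT (s y) in
  - \sum_i nabla_theta s (e x i) (fun y => nabla_theta s (e y i) (Psi s))
  - \sum_i (divergence e (fun y => e y i) x)%:C *:
      nabla_theta s (e x i) (Psi s).

(* The trace is taken in an orthonormal frame [e], on which it does not depend. *)
Definition scalar_curvature (e : forall y, 'I_n -> tangent A y) x : R :=
  \sum_i \sum_j
    g (curvature nablaM x (fun y => e y i) (fun y => e y j) (fun y => e y j))
      (e x i).

Definition Theta (s : forall y, P y) x (k l : 'I_r) (X Y : vector_field A) : R :=
  inner (curvature nablaF x X Y (fun y => frameF (s y) k)) (frameF (s x) l).

Definition twisted_curvature (Psi : gauge_field) : gauge_field := fun s x =>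
  \sum_(k < r) \sum_(l < r | (k < l)%N) \sum_(i < n) \sum_(j < n | (i < j)%N)
    (Theta s x k l (fun y => frameT (s y) i) (fun y => frameT (s y) j))%:C *:
    clifford_act (clifford_gen R i * clifford_gen R j)
      (twist_act (clifford_gen R k * clifford_gen R l) (Psi s x)).

End Spinors.
End SpinStructure.

(* Main.v *)
(* In a gauge, the covariant derivative of a spinor is the ordinary derivative plus
   the action of the lifted connection forms of [TM] and [F].  It satisfies the
   Leibniz rule for Clifford multiplication, so that D D is the sum over i, j of
   e_i e_j acting on F_ij, where F_ij is nabla_(e_i) nabla_(e_j) plus terms of
   first order.  The diagonal terms give the connection Laplacian.  For i < j only
   F_ij - F_ji matters; there the first order terms cancel because the Levi-Civita
   connection has no torsion, which leaves the curvature of the spinor bundle.  Its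
   part from [F] is the twisted curvature term, and the first Bianchi identity
   contracts its part from [TM] to a quarter of the scalar curvature.
   Locality of derivations needs no bump functions: smoothness is only required
   near a point, so the indicator function of a neighbourhood is admissible. *)
Require Import Defs.
From HB Require Import structures.
From mathcomp Require Import all_boot all_order all_algebra complex mxtens.
From mathcomp Require Import all_classical all_reals all_analysis.
From mathcomp Require Import ring lra.
Set Implicit Arguments.
Unset Strict Implicit.
Unset Printing Implicit Defensive.
Import Order.TTheory GRing.Theory Num.Theory numFieldNormedType.Exports.
Local Open Scope classical_set_scope.
Local Open Scope ring_scope.
Local Open Scope complex_scope.

(** * Smooth functions and derivations *)

(** The sections and forms of a gauge are total functions on [M], but they are smooth only near the
    given point, so most identities between derivatives hold only there. Before such an identity can
    be differentiated again, derivations and connections must be shown to depend on germs only, and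
    smoothness at [x] must be spread to a neighbourhood. Clifford multiplication by the tangent
    directions comes from an algebra morphism, while the action on the [m]-th tensor power preserves
    commutators but in general not products. The curvature is therefore computed through
    commutators, and the two parts decouple because they act on different tensor factors. The factor
    1/2 of the twisted term is the constant of the lift of so(r) to the Lie algebra of Spin(r). The
    factor 1/4 of the scalar curvature is a product: 1/2 for passing from all pairs to [i < j], 1/4
    for the lift written over all pairs, -2 from the cyclic identity, and -1 from the square of a
    generator. *)

Section SmoothOnOpen.
Variables (R : realType) (n : nat).
Implicit Types (U V : set 'rV[R]_n) (h : 'rV[R]_n -> R).

Lemma open_near_eq U h1 h2 z : open U -> U z -> (forall y, U y -> h1 y = h2 y) ->
  \near z, h1 z = h2 z.
Proof.
by move=> oU Uz h12; near=> y; apply: h12; near: y; exact: open_nbhs_nbhs.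
Unshelve. all: by end_near. Qed.

(** The first-order expansion of [h1] at [z] is also one for [h2], and such an expansion determines
    the differential. *)
Lemma near_eq_differentiable h1 h2 z : (\near z, h1 z = h2 z) -> differentiable h1 z ->
  differentiable h2 z.
Proof.
move=> e /[dup] /diff_locally/eqaddoP d /diff_continuous c.
have {}d : h2 \o shift z = cst (h2 z) + 'd h1 z +o_ 0 id.
  apply/eqaddoP => _/posnumP[a]; have := d a%:num [gt0 of a%:num].
  rewrite -(nbhs_singleton e); apply: filter_app.
  have : \forall y \near (0 : 'rV[R]_n), h1 (y + z) = h2 (y + z).
    have e' := e; rewrite (near_shift 0) subr0 in e'.
    by apply: filterS e'.
  by apply: filterS => y /= ; rewrite !fctE /= => ->.
have dE : 'd h2 z = 'd h1 z :> (_ -> _) by exact: diff_unique c d.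
by apply/diff_locallyP; rewrite dE.
Unshelve. all: by end_near. Qed.

Lemma Ck_on_eq k U h1 h2 : open U -> (forall z, U z -> h1 z = h2 z) ->
  Ck_on k U h1 -> Ck_on k U h2.
Proof.
move=> oU; elim: k h1 h2 => [|k IHk] h1 h2 h12 /= => [c z Uz|[d D]].
  have e : \near z, h1 z = h2 z by apply: open_near_eq Uz h12.
  rewrite /prop_for /continuous_at -h12//.
  exact: cvg_trans (near_eq_cvg e) (c z Uz).
split=> [z Uz|j]; first by apply: near_eq_differentiable (d z Uz); apply: open_near_eq Uz h12.
apply: IHk (D j) => z Uz; apply: near_eq_derive; exact: open_near_eq Uz h12.
Qed.

Lemma Ck_on_sub k U V h : V `<=` U -> Ck_on k U h -> Ck_on k V h.
Proof.
move=> VU; elim: k h => [|k IHk] h /= => [c z /VU /c //|[d D]].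
by split=> [z /VU /d //|j]; apply: IHk (D j).
Qed.

Lemma Ck_onW k U h : Ck_on k.+1 U h -> Ck_on k U h.
Proof.
elim: k h => [|k IHk] h /= => [[d _] z Uz|[d D]].
  exact: differentiable_continuous (d z Uz).
by split=> // j; apply: IHk (D j).
Qed.

Lemma Ck_on_cst k U (a : R) : Ck_on k U (cst a).
Proof.
elim: k a => [|k IHk] a /=; first by move=> z _; exact: cst_continuous.
split=> [z _|j]; first exact: differentiable_cst.
by under eq_fun => z do rewrite derive_cst; apply: IHk.
Qed.

Lemma Ck_onD k U h1 h2 : open U -> Ck_on k U h1 -> Ck_on k U h2 ->
  Ck_on k U (fun z => h1 z + h2 z).
Proof.
move=> oU; elim: k h1 h2 => [|k IHk] h1 h2 /= => [c1 c2 z Uz|[d1 D1] [d2 D2]].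
  by apply: (@continuousD _ _ _ h1 h2); [exact: c1|exact: c2].
split=> [z Uz|j]; first by apply: (@differentiableD _ _ _ h1 h2); [exact: d1|exact: d2].
apply: Ck_on_eq (IHk _ _ (D1 j) (D2 j)) => // z Uz.
by rewrite -(@deriveD _ _ _ h1 h2) //; exact/diff_derivable/d1 || exact/diff_derivable/d2.
Qed.

Lemma Ck_onM k U h1 h2 : open U -> Ck_on k U h1 -> Ck_on k U h2 ->
  Ck_on k U (fun z => h1 z * h2 z).
Proof.
move=> oU; elim: k h1 h2 => [|k IHk] h1 h2 => [/= c1 c2 z Uz|c1 c2].
  by apply: (@continuousM _ _ h1 h2); [exact: c1|exact: c2].
have [d1 D1] := c1; have [d2 D2] := c2.
split=> [z Uz|j]; first by apply: (@differentiableM _ _ h1 h2); [exact: d1|exact: d2].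
(* The product rule leaves one factor undifferentiated; it is lowered to order [k] to meet the
   induction hypothesis. *)
have C1 := Ck_onW c1; have C2 := Ck_onW c2.
apply: Ck_on_eq (Ck_onD oU (IHk _ _ C1 (D2 j)) (IHk _ _ C2 (D1 j))) => // z Uz.
rewrite (_ : (fun z => h1 z * h2 z) = h1 * h2)// deriveM//.
  exact/diff_derivable/d1.
exact/diff_derivable/d2.
Qed.

End SmoothOnOpen.

Section SmoothFunctions.
Variables (R : realType) (n : nat) (M : topologicalType) (A : atlas R n M).
Hypothesis manA : oriented_manifold A.
Implicit Types (x y : M) (f h : M -> R) (W : set M).

(** Openness turns equality on a chart image into equality near each of its points, as the
    derivatives in [Ck_on] require. A point [z] of the full image with [param c z] in [W] lies in
    the image of [W]. *)
Lemma open_chart_image (c : chart A) W : open W -> open (chart_image c W).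
Proof.
move=> oW; rewrite openE => _ [x [Wx dx] <-]; rewrite /interior.
have im_x : chart_image c setT (Defs.coord c x) by exists x.
have pW : \forall z \near Defs.coord c x, W (param c z).
  have := param_continuous manA im_x; rewrite /prop_for/continuous_at (coordK manA)//.
  by apply; exact: open_nbhs_nbhs.
have im_near : \forall z \near Defs.coord c x, chart_image c setT z.
  by apply: open_nbhs_nbhs; split=> //; exact: (image_open manA).
near=> z; have [y [_ dy] yz] : chart_image c setT z by near: z.
exists y => //; split=> //; rewrite -(coordK manA dy) yz; near: z; exact: pW.
Unshelve. all: by end_near. Qed.

Lemma smooth_near_within x f W : open W -> W x -> smooth_near A x f ->
  exists V, [/\ open V, V x, V `<=` W &
    forall (c : chart A) k, Ck_on k (chart_image c V) (f \o param c)].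
Proof.
move=> oW Wx [V [oV Vx fV]]; exists (V `&` W); split=> //; first exact: openI.
move=> c k; apply: Ck_on_sub (fV c k) => _ [y [[Vy _] dy] <-].
by exists y.
Qed.

Lemma smooth_near_eq x f h : (\forall y \near x, f y = h y) ->
  smooth_near A x f -> smooth_near A x h.
Proof.
move=> fh0; have : nbhs x [set y | f y = h y] by [].
rewrite nbhsE /= => -[W [oW Wx] fh] /(smooth_near_within oW Wx).
move=> [V [oV Vx VW fV]]; exists V; split=> // c k.
apply: Ck_on_eq (fV c k); first exact: open_chart_image.
move=> _ [y [Vy dy] <-] /=; rewrite (coordK manA) //; exact/fh/VW.
Qed.

Lemma smooth_near_open x f : smooth_near A x f ->
  \forall y \near x, smooth_near A y f.
Proof.
move=> [W [oW Wx fW]]; have : nbhs x W by exact: open_nbhs_nbhs.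
by apply: filterS => y Wy; exists W.
Qed.

Lemma smooth_near_cst x (a : R) : smooth_near A x (fun=> a).
Proof.
by exists setT; split=> //; [exact: openT|move=> c k; exact: (@Ck_on_cst R n k _ a)].
Qed.

Lemma smooth_nearD x f h : smooth_near A x f -> smooth_near A x h ->
  smooth_near A x (fun y => f y + h y).
Proof.
move=> [W [oW Wx fW]] /(smooth_near_within oW Wx)[V [oV Vx VW hV]].
exists V; split=> // c k; apply: (@Ck_onD _ _ k _ (f \o _) (h \o _)) => //.
  exact: open_chart_image.
by apply: Ck_on_sub (fW c k) => _ [y [Vy dy] <-]; exists y => //; split=> //; exact: VW.
Qed.

Lemma smooth_nearM x f h : smooth_near A x f -> smooth_near A x h ->
  smooth_near A x (fun y => f y * h y).
Proof.
move=> [W [oW Wx fW]] /(smooth_near_within oW Wx)[V [oV Vx VW hV]].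
exists V; split=> // c k; apply: (@Ck_onM _ _ k _ (f \o _) (h \o _)) => //.
  exact: open_chart_image.
by apply: Ck_on_sub (fW c k) => _ [y [Vy dy] <-]; exists y => //; split=> //; exact: VW.
Qed.

Lemma smooth_nearZ x (a : R) f : smooth_near A x f ->
  smooth_near A x (fun y => a * f y).
Proof. by apply: smooth_nearM; exact: smooth_near_cst. Qed.

Lemma smooth_nearN x f : smooth_near A x f -> smooth_near A x (fun y => - f y).
Proof.
by move=> /(smooth_nearZ (-1)); apply: smooth_near_eq; near=> y; rewrite mulN1r.
Unshelve. all: by end_near. Qed.

Lemma smooth_nearB x f h : smooth_near A x f -> smooth_near A x h ->
  smooth_near A x (fun y => f y - h y).
Proof. by move=> sf /smooth_nearN; exact: smooth_nearD. Qed.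

Lemma smooth_near_sum (I : Type) (s : seq I) (p : pred I) x (F : I -> M -> R) :
  (forall i, p i -> smooth_near A x (F i)) ->
  smooth_near A x (fun y => \sum_(i <- s | p i) F i y).
Proof.
move=> sF; elim: s => [|i s IHs].
  by under eq_fun do rewrite big_nil; exact: smooth_near_cst.
under eq_fun do rewrite big_cons; case pi: (p i) => //.
by apply: smooth_nearD => //; exact: sF.
Qed.

End SmoothFunctions.

(** * Derivations and their dependence on germs *)

Section Derivations.
Variables (R : realType) (n : nat) (M : topologicalType) (A : atlas R n M).
Hypothesis manA : oriented_manifold A.
Implicit Types (x y : M) (f h : M -> R) (X Y Z : vector_field A).

Lemma tangent_derivation x (v : tangent A x) : derivation_at A x v.
Proof. exact/asboolP/(tangentP v). Qed.

Lemma tangentDE x (u v : tangent A x) f : (u + v) f = u f + v f.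
Proof. by []. Qed.

Lemma tangentBE x (u v : tangent A x) f : (u - v) f = u f - v f.
Proof. by []. Qed.

Lemma tangentZE x a (v : tangent A x) f : (a *: v) f = a * v f.
Proof. by []. Qed.

Lemma tangentZD x (v : tangent A x) a f h : smooth_near A x f ->
  smooth_near A x h -> v (fun y => a * f y + h y) = a * v f + v h.
Proof. exact: derivation_linear (tangent_derivation v) a f h. Qed.

Lemma tangentM x (v : tangent A x) f h : smooth_near A x f -> smooth_near A x h ->
  v (fun y => f y * h y) = v f * h x + f x * v h.
Proof. exact: derivation_leibniz (tangent_derivation v) f h. Qed.

Lemma tangentD x (v : tangent A x) f h : smooth_near A x f ->
  smooth_near A x h -> v (fun y => f y + h y) = v f + v h.
Proof.
by move=> sf sh; rewrite -[v f]mul1r -tangentZD//; congr (v _); apply/funext => y; rewrite mul1r.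
Qed.

Lemma tangent0 x (v : tangent A x) : v (fun=> 0) = 0.
Proof.
have := @tangentD x v _ _ (smooth_near_cst A x 0) (smooth_near_cst A x 0).
by rewrite (_ : (fun=> _) = fun=> 0) => [|]; [lra|apply/funext => y; rewrite addr0].
Qed.

Lemma tangentZ x (v : tangent A x) a f : smooth_near A x f ->
  v (fun y => a * f y) = a * v f.
Proof.
move=> sf; rewrite -[RHS]addr0 -(tangent0 v) -tangentZD//; last exact: smooth_near_cst.
by congr (v _); apply/funext => y; rewrite addr0.
Qed.

Lemma tangentN x (v : tangent A x) f : smooth_near A x f ->
  v (fun y => - f y) = - v f.
Proof.
by move=> sf; rewrite -mulN1r -tangentZ//; congr (v _); apply/funext => y; rewrite mulN1r.
Qed.

Lemma tangentB x (v : tangent A x) f h : smooth_near A x f ->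
  smooth_near A x h -> v (fun y => f y - h y) = v f - v h.
Proof.
by move=> sf sh; rewrite tangentD ?tangentN//; exact: smooth_nearN.
Qed.

Lemma tangent_cst x (v : tangent A x) a : v (fun=> a) = 0.
Proof.
have s1 := smooth_near_cst A x 1.
(* The Leibniz rule for [1 * 1 = 1] reads [v 1 = v 1 + v 1]. *)
have v1 : v (fun=> 1) = 0.
  have := tangentM v s1 s1; rewrite (_ : (fun=> _) = fun=> 1); first lra.
  by apply/funext => y; rewrite mulr1.
rewrite (_ : (fun=> a) = (fun=> a * 1)); first by rewrite tangentZ// v1 mulr0.
by apply/funext => y; rewrite mulr1.
Qed.

(* The indicator function [1_W] of a neighbourhood [W] of [x] is smooth near [x],
   and [1_W f = 1_W h] holds everywhere when [f = h] on [W]. *)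
Lemma near_indicator x W : nbhs x W ->
  smooth_near A x (\1_W : M -> R) /\ (forall v : tangent A x, v \1_W = 0).
Proof.
rewrite nbhsE /= => -[V [oV Vx] VW].
have e1 : \forall y \near x, 1 = (\1_W : M -> R) y.
  have : nbhs x V by exact: open_nbhs_nbhs.
  by apply: filterS => y /VW Wy; rewrite indicE mem_set.
have s1 : smooth_near A x (\1_W : M -> R).
  by apply: (smooth_near_eq manA e1); exact: smooth_near_cst.
split=> // v; have := tangentM v s1 s1; rewrite (_ : (fun _ => _) = \1_W).
  by rewrite -(nbhs_singleton e1); lra.
by apply/funext => y; rewrite !indicE; case: (y \in W); rewrite ?mulr1 ?mulr0.
Qed.

(** For [W] the set where [f] and [h] agree, multiplying by [\1_W] does not change the value of [v],
    because [\1_W x = 1] and [v \1_W = 0]; the latter is the Leibniz rule for an idempotent. If [f]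
    is not smooth near [x], neither is [h], and both values are 0. *)
Lemma tangent_near_eq x (v : tangent A x) f h : (\forall y \near x, f y = h y) ->
  v f = v h.
Proof.
move=> fh; have [sf|nf] := pselect (smooth_near A x f); last first.
  rewrite !(derivation_junk (tangent_derivation v))// => sh.
  by apply: nf; apply: (smooth_near_eq manA) sh; apply: filterS fh.
have sh := smooth_near_eq manA fh sf.
pose W := [set y | f y = h y]; have [s1 v1] := @near_indicator x W fh.
have Wx : (\1_W : M -> R) x = 1 by rewrite indicE mem_set //; exact: (nbhs_singleton fh).
have -> : v f = v (fun y => \1_W y * f y) by rewrite tangentM// v1 Wx mul0r add0r mul1r.
have -> : v h = v (fun y => \1_W y * h y) by rewrite tangentM// v1 Wx mul0r add0r mul1r.
congr (v _); apply/funext => y; rewrite indicE.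
by have [/set_mem ->|] := boolP (y \in W); rewrite ?mul0r.
Qed.

Lemma tangentP_eq x (u v : tangent A x) :
  (forall f, smooth_near A x f -> u f = v f) -> u = v.
Proof.
move=> uv; apply/val_inj/funext => f.
have [/uv //|nf] := pselect (smooth_near A x f).
by rewrite /= (derivation_junk (tangent_derivation u))//
  (derivation_junk (tangent_derivation v)).
Qed.

End Derivations.

(** * Smooth vector fields and the Lie bracket *)

Section VectorFields.
Variables (R : realType) (n : nat) (M : topologicalType) (A : atlas R n M).
Hypothesis manA : oriented_manifold A.
Implicit Types (x y : M) (f h : M -> R) (X Y Z : vector_field A).

(** This is [smooth_section] of the tangent bundle unfolded, which frees it from the choice of a
    metric. *)
Definition smooth_field x X := \forall y \near x,
  forall f, smooth_near A y f -> smooth_near A y (fun z => X z f).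

Lemma smooth_field_open x X : smooth_field x X -> \forall y \near x, smooth_field y X.
Proof. exact: nbhs_interior. Qed.

Lemma smooth_field_apply x X f : smooth_field x X -> smooth_near A x f ->
  smooth_near A x (fun y => X y f).
Proof. by move=> /nbhs_singleton; apply. Qed.

Lemma smooth_field0 x : smooth_field x (fun=> 0).
Proof. by near=> y => f _; exact: smooth_near_cst. Unshelve. all: by end_near. Qed.

Lemma smooth_fieldD x X Y : smooth_field x X -> smooth_field x Y ->
  smooth_field x (fun y => X y + Y y).
Proof.
move=> sX sY; near=> y => f sf; apply: (@smooth_nearD _ _ _ _ manA y (fun z => X z f)).
  by move: f sf; near: y; exact: sX.
by move: f sf; near: y; exact: sY.
Unshelve. all: by end_near. Qed.

Lemma smooth_fieldZ x h X : smooth_near A x h -> smooth_field x X ->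
  smooth_field x (fun y => h y *: X y).
Proof.
move=> /smooth_near_open sh sX; near=> y => f sf.
apply: (@smooth_nearM _ _ _ _ manA y h (fun z => X z f)); first by near: y.
by move: f sf; near: y; exact: sX.
Unshelve. all: by end_near. Qed.

(** The commutator is a derivation: on a product, the mixed first-order terms are symmetric in [X]
    and [Y] and cancel. The inner derivative obeys its rules only at points near [x], whence the use
    of [tangent_near_eq]. *)
Lemma lie_bracketE x X Y f : smooth_field x X -> smooth_field x Y ->
  smooth_near A x f ->
  lie_bracket X Y x f = X x (fun y => Y y f) - Y x (fun y => X y f).
Proof.
move=> sX sY sf; rewrite /lie_bracket insubdK; last first; last first.
  by case: asboolP.
have sXf h : smooth_near A x h -> smooth_near A x (fun y => X y h).
  exact: smooth_field_apply.
have sYf h : smooth_near A x h -> smooth_near A x (fun y => Y y h).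
  exact: smooth_field_apply.
have nD (V : vector_field A) a h1 h2 : smooth_near A x h1 -> smooth_near A x h2 ->
    \forall y \near x, V y (fun z => a * h1 z + h2 z) = a * V y h1 + V y h2.
  move=> /smooth_near_open s1 /smooth_near_open s2; near=> y.
  by apply: tangentZD; near: y.
have nM (V : vector_field A) h1 h2 : smooth_near A x h1 -> smooth_near A x h2 ->
    \forall y \near x, V y (fun z => h1 z * h2 z) = V y h1 * h2 y + h1 y * V y h2.
  move=> /smooth_near_open s1 /smooth_near_open s2; near=> y.
  by apply: tangentM; near: y.
apply/asboolP; split=> [a h1 h2 s1 s2|h1 h2 s1 s2|h ns]; last by case: asboolP.
  have s12 : smooth_near A x (fun z => a * h1 z + h2 z).
    by apply: smooth_nearD => //; exact: smooth_nearZ.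
  do 3![case: asboolP => // _].
  rewrite (tangent_near_eq manA (X x) (nD Y a h1 h2 s1 s2)).
  rewrite (tangent_near_eq manA (Y x) (nD X a h1 h2 s1 s2)).
  by rewrite !tangentZD//; [ring|exact: sXf..|exact: sYf|exact: sYf].
have s12 : smooth_near A x (fun z => h1 z * h2 z) by exact: smooth_nearM.
do 3![case: asboolP => // _].
rewrite (tangent_near_eq manA (X x) (nM Y h1 h2 s1 s2)).
rewrite (tangent_near_eq manA (Y x) (nM X h1 h2 s1 s2)).
have sX1 := sXf _ s1; have sX2 := sXf _ s2; have sY1 := sYf _ s1; have sY2 := sYf _ s2.
rewrite !tangentD ?tangentM//; first by ring.
all: exact: smooth_nearM.
Unshelve. all: by end_near. Qed.

Lemma smooth_field_lie x X Y : smooth_field x X -> smooth_field x Y ->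
  smooth_field x (lie_bracket X Y).
Proof.
move=> /smooth_field_open sX /smooth_field_open sY; near=> y => f sf.
have sXy : smooth_field y X by near: y.
have sYy : smooth_field y Y by near: y.
apply: (smooth_near_eq manA (f := fun z => X z (fun t => Y t f) - Y z (fun t => X t f))).
  have := smooth_field_open sXy; have := smooth_field_open sYy.
  have := smooth_near_open sf => nf nY nX; near=> z.
  by rewrite lie_bracketE//; near: z.
by apply: smooth_nearB => //; apply: smooth_field_apply => //; apply: smooth_field_apply.
Unshelve. all: by end_near. Qed.

Lemma lie_bracketN x X Y : smooth_field x X -> smooth_field x Y ->
  lie_bracket X Y x = - lie_bracket Y X x.
Proof.
move=> sX sY; apply: tangentP_eq => f sf.
by rewrite -[- _]sub0r tangentBE !lie_bracketE//= sub0r opprB.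
Qed.

Lemma lie_bracket_jacobi x X Y Z :
  smooth_field x X -> smooth_field x Y -> smooth_field x Z ->
  lie_bracket X (lie_bracket Y Z) x + lie_bracket Y (lie_bracket Z X) x
    + lie_bracket Z (lie_bracket X Y) x = 0.
Proof.
move=> sX sY sZ; apply: tangentP_eq => f sf.
(* Each double bracket yields four third-order derivatives of [f]; the twelve terms cancel in
   pairs. *)
have nE U V W : smooth_field x U -> smooth_field x V -> smooth_field x W ->
    lie_bracket U (lie_bracket V W) x f =
    U x (fun y => V y (fun z => W z f)) - U x (fun y => W y (fun z => V z f))
    - (V x (fun y => W y (fun z => U z f)) - W x (fun y => V y (fun z => U z f))).
  move=> sU sV sW; rewrite lie_bracketE ?lie_bracketE//; last 2 first.
  - exact: smooth_field_apply.
  - exact: smooth_field_lie.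
  rewrite -tangentB//; try by do 2!apply: smooth_field_apply => //.
  congr (_ - _); apply: (tangent_near_eq manA).
  have nV := smooth_field_open sV; have nW := smooth_field_open sW.
  have nf := smooth_near_open sf; near=> y.
  by rewrite lie_bracketE//; near: y.
rewrite !tangentDE !nE// [RHS](_ : _ = 0)//; ring.
Unshelve. all: by end_near. Qed.

End VectorFields.

(** * Inner products and smooth sections *)

Section InnerProduct.
Variables (R : realType) (M : topologicalType) (k : nat) (E : vbundle R M k).
Hypothesis innE : inner_product_axioms E.
Variable x : M.
Implicit Types u v w : E x.

Lemma innerC u v : inner u v = inner v u.
Proof. exact: (inner_sym innE). Qed.

Lemma innerDl u v w : inner (u + v) w = inner u w + inner v w.
Proof. by rewrite -[u]scale1r (inner_linear innE) mul1r scale1r. Qed.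

Lemma inner0l w : inner 0 w = 0.
Proof. by have := innerDl 0 0 w; rewrite addr0; lra. Qed.

Lemma innerZl a u w : inner (a *: u) w = a * inner u w.
Proof. by rewrite -[a *: u]addr0 (inner_linear innE) inner0l addr0. Qed.

Lemma innerNl u w : inner (- u) w = - inner u w.
Proof. by rewrite -scaleN1r innerZl mulN1r. Qed.

Lemma innerBl u v w : inner (u - v) w = inner u w - inner v w.
Proof. by rewrite innerDl innerNl. Qed.

Lemma inner_suml (I : Type) (s : seq I) (p : pred I) (u : I -> E x) w :
  inner (\sum_(i <- s | p i) u i) w = \sum_(i <- s | p i) inner (u i) w.
Proof.
by elim/big_rec2 : _ => [|i b a _ <-]; rewrite ?inner0l// innerDl.
Qed.

Lemma inner_frame (e : 'I_k -> E x) (a : 'I_k -> R) j : orthonormal_basis e ->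
  inner (\sum_i a i *: e i) (e j) = a j.
Proof.
move=> [on _]; rewrite inner_suml (bigD1 j)//= innerZl on eqxx mulr1 big1 ?addr0//.
by move=> i ij; rewrite innerZl on (negPf ij) mulr0.
Qed.

Lemma inner_expand (e : 'I_k -> E x) u v : orthonormal_basis e ->
  inner u v = \sum_i inner u (e i) * inner v (e i).
Proof.
move=> [_ b]; rewrite {1}(b u) inner_suml; apply: eq_bigr => i _.
by rewrite innerZl [inner (e i) v]innerC.
Qed.

End InnerProduct.

Section Sections.
Variables (R : realType) (n : nat) (M : topologicalType) (A : atlas R n M).
Hypothesis manA : oriented_manifold A.

(* The properties of smooth sections shared by [TM] and the auxiliary bundle. *)
Record section_axioms k (E : vbundle R M k) : Prop := SectionAxioms {
  section_inner_axioms : inner_product_axioms E;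
  section_open : forall x (s : forall y, E y), smooth_section x s ->
    \forall y \near x, smooth_section y s;
  section0 : forall x, smooth_section x (fun y => 0 : E y);
  sectionD : forall x (s t : forall y, E y), smooth_section x s ->
    smooth_section x t -> smooth_section x (fun y => s y + t y);
  sectionZ : forall x f (s : forall y, E y), smooth_near A x f ->
    smooth_section x s -> smooth_section x (fun y => f y *: s y);
  section_inner : forall x (s t : forall y, E y), smooth_section x s ->
    smooth_section x t -> smooth_near A x (fun y => inner (s y) (t y)) }.

Lemma tangent_section_axioms (g : forall x : M, tangent A x -> tangent A x -> R) :
  riemannian_metric g -> section_axioms (tangent_bundle g).
Proof.
move=> metg; split.
- exact: metric_inner metg.
- by move=> x s; exact: smooth_field_open.
- by move=> x; exact: smooth_field0.
- by move=> x s t; exact: smooth_fieldD.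
- by move=> x f s; exact: smooth_fieldZ.
- by move=> x s t; exact: metric_smooth metg _ _ _.
Qed.

(** In the local frame of [bundle_trivial] a section is smooth when its coefficients are, so each
    clause reduces to one on functions; the inner product is the sum of the products of
    coefficients. *)
Lemma bundle_section_axioms k (E : vbundle R M k) :
  oriented_riemannian_bundle A E -> section_axioms E.
Proof.
move=> bE; have iE := bundle_inner bE.
split=> // [x s|x|x s t|x f s|x s t]; have [e ne] := bundle_trivial bE x;
  have e0 := (nbhs_singleton ne).2.
- move=> /e0 ss; have {}ss i := smooth_near_open (ss i).
  have : \forall y \near x, forall i, smooth_near A y (fun y => inner (s y) (e y i)).
    exact: filter_forall.
  by move: ne; apply: filterS2 => y [_ ey] /ey.
- by apply/e0 => i; under eq_fun do rewrite (inner0l iE); exact: smooth_near_cst.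
- move=> /e0 ss /e0 st; apply/e0 => i; under eq_fun do rewrite (innerDl iE).
  exact: smooth_nearD.
- move=> sf /e0 ss; apply/e0 => i; under eq_fun do rewrite (innerZl iE).
  exact: smooth_nearM.
- move=> /e0 ss /e0 st.
  apply: (smooth_near_eq manA
    (f := fun y => \sum_i inner (s y) (e y i) * inner (t y) (e y i))).
    by apply: filterS ne => y [[oy _] _]; rewrite -(inner_expand iE).
  by apply: smooth_near_sum => // i _; exact: smooth_nearM.
Unshelve. all: by end_near. Qed.

Lemma section_sum k (E : vbundle R M k) x (I : Type) (s : seq I)
    (t : I -> forall y, E y) : section_axioms E ->
  (forall i, smooth_section x (t i)) ->
  smooth_section x (fun y => \sum_(i <- s) t i y).
Proof.
move=> aE st; elim: s => [|i s IHs].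
  rewrite (_ : (fun y => _) = (fun y => 0 : E y)); first exact: section0.
  by apply/functional_extensionality_dep => y; rewrite big_nil.
rewrite (_ : (fun y => _) = (fun y => t i y + \sum_(i <- s) t i y)).
  exact: sectionD.
by apply/functional_extensionality_dep => y; rewrite big_cons.
Qed.

End Sections.

(** * Connections and curvature *)

Section Connections.
Variables (R : realType) (n : nat) (M : topologicalType) (A : atlas R n M).
Variables (g : forall x : M, tangent A x -> tangent A x -> R).
Variables (k : nat) (E : vbundle R M k) (nabla : connection A E).
Hypotheses (manA : oriented_manifold A) (secE : section_axioms A E).
Hypothesis metE : metric_connection g nabla.
Implicit Types (x y : M) (s t : forall y, E y) (X Y : vector_field A).

Lemma connection0l x s : smooth_section x s -> nabla (0 : tangent A x) s = 0.
Proof.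
move=> ss; have := connection_tensorial metE 1 (0 : tangent A x) 0 ss.
rewrite !scale1r addr0 => /eqP.
by rewrite -subr_eq0 opprD addrA subrr sub0r oppr_eq0 => /eqP.
Qed.

Lemma connectionDl x (u v : tangent A x) s : smooth_section x s ->
  nabla (u + v) s = nabla u s + nabla v s.
Proof.
by move=> ss; have := connection_tensorial metE 1 u v ss; rewrite !scale1r.
Qed.

Lemma connectionZl x a (v : tangent A x) s : smooth_section x s ->
  nabla (a *: v) s = a *: nabla v s.
Proof.
move=> ss; have := connection_tensorial metE a v 0 ss.
by rewrite connection0l// !addr0.
Qed.

(** The indicator argument again: by the Leibniz rule of [nabla], multiplying a section by [\1_W]
    does not change its derivative at [x]. *)
Lemma connection_near_eq x (v : tangent A x) s t : smooth_section x s ->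
  smooth_section x t -> (\forall y \near x, s y = t y) -> nabla v s = nabla v t.
Proof.
move=> ss st e; pose W := [set y | s y = t y].
have [sW vW] := @near_indicator _ _ _ _ manA x W e.
have Wx : (\1_W : M -> R) x = 1 by rewrite indicE mem_set //; exact: (nbhs_singleton e).
have loc r : smooth_section x r -> nabla v r = nabla v (fun y => (\1_W : M -> R) y *: r y).
  by move=> sr; rewrite (connection_leibniz metE)// vW Wx scale0r add0r scale1r.
rewrite (loc s)// (loc t)//; congr (nabla v _).
apply/functional_extensionality_dep => y; rewrite indicE.
by have [/set_mem ->|] := boolP (y \in W); rewrite ?scale0r.
Qed.

Lemma connection0 x (v : tangent A x) : nabla v (fun y => 0 : E y) = 0.
Proof.
have := connection_leibniz metE v (smooth_near_cst A x 0) (section0 secE x).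
rewrite tangent_cst !scale0r addr0 => <-; congr (nabla v _).
by apply/functional_extensionality_dep => y; rewrite scale0r.
Qed.

Lemma connection_sum x (v : tangent A x) (I : Type) (r : seq I)
    (s : I -> forall y, E y) : (forall i, smooth_section x (s i)) ->
  nabla v (fun y => \sum_(i <- r) s i y) = \sum_(i <- r) nabla v (s i).
Proof.
move=> ss; elim: r => [|i r IHr].
  rewrite big_nil -[RHS](connection0 v); congr (nabla v _).
  by apply/functional_extensionality_dep => y; rewrite big_nil.
rewrite big_cons -IHr -(connection_additive metE)//; last exact: (section_sum _ secE).
congr (nabla v _).
by apply/functional_extensionality_dep => y; rewrite big_cons.
Qed.

Section Frame.
Variable e : forall y, 'I_k -> E y.
(** Assumed at every point, because the frames of a gauge are orthonormal even where the gauge is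
    not smooth. Expansions in the frame are thus equalities of functions on all of [M]; smoothness
    is assumed at [x] alone. *)
Hypothesis one : forall y, orthonormal_basis (e y).
Local Notation w := (connection_form nabla e).
Local Notation iE := (section_inner_axioms secE).

(** Differentiate the constant functions [inner (e y i) (e y j)]. *)
Lemma connection_form_skew x (v : tangent A x) i j :
  (forall l, smooth_section x (fun y => e y l)) -> w v i j = - w v j i.
Proof.
move=> se; have := connection_metric metE v (se i) (se j).
rewrite (_ : (fun y => _) = fun=> (i == j)%:R); last first.
  by apply/funext => y; exact: (one y).1.
rewrite tangent_cst [X in _ + X](innerC iE) => /esym/eqP.
by rewrite addr_eq0 => /eqP.
Qed.

Variable x : M.
Hypothesis se : forall i, smooth_section x (fun y => e y i).
Lemma connection_frameE y (v : tangent A y) i :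
  nabla v (fun y => e y i) = \sum_j w v i j *: e y j.
Proof. exact: (one y).2. Qed.

Lemma connection_formDl (u v : tangent A x) i j : w (u + v) i j = w u i j + w v i j.
Proof. by rewrite /connection_form connectionDl// (innerDl iE). Qed.

Lemma connection_formZl a (v : tangent A x) i j : w (a *: v) i j = a * w v i j.
Proof. by rewrite /connection_form connectionZl// (innerZl iE). Qed.

Lemma connection_form_smooth X i j : smooth_field x X ->
  smooth_near A x (fun y => w (X y) i j).
Proof.
by move=> sX; apply: (section_inner secE) => //; exact: (connection_smooth metE).
Qed.

Let nabla2E X (v : tangent A x) i l : smooth_field x X ->
  inner (nabla v (fun y => nabla (X y) (fun y => e y i))) (e x l) =
  v (fun y => w (X y) i l) + \sum_p w (X x) i p * w v p l.
Proof.
move=> sX.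
rewrite (_ : (fun y => nabla _ _) = fun y => \sum_p w (X y) i p *: e y p); last first.
  by apply/functional_extensionality_dep => y; exact: connection_frameE.
have sw p : smooth_near A x (fun y => w (X y) i p) by exact: connection_form_smooth.
rewrite (@connection_sum x v _ _ (fun p y => w (X y) i p *: e y p)); last first.
  by move=> p; exact: (sectionZ secE (sw p) (se p)).
under eq_bigr do rewrite (connection_leibniz metE)//.
rewrite big_split /= (innerDl iE) (inner_frame iE)//; congr (_ + _).
by rewrite (inner_suml iE); apply: eq_bigr => p _; rewrite (innerZl iE).
Qed.

(** Cartan's second structure equation. Row [i] of [w v] holds the coefficients of [nabla v e_i], so
    iterated derivatives multiply these matrices in reverse order; hence the sign of the quadratic
    term. *)
Lemma curvatureE X Y i l : smooth_field x X -> smooth_field x Y ->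
  inner (curvature nabla x X Y (fun y => e y i)) (e x l) =
  X x (fun y => w (Y y) i l) - Y x (fun y => w (X y) i l)
  - w (lie_bracket X Y x) i l
  + (\sum_p w (Y x) i p * w (X x) p l - \sum_p w (X x) i p * w (Y x) p l).
Proof.
move=> sX sY; rewrite /curvature !(innerBl iE) !nabla2E// /connection_form.
by ring.
Qed.

Lemma curvature_skewr X Y i l : smooth_field x X -> smooth_field x Y ->
  inner (curvature nabla x X Y (fun y => e y i)) (e x l) =
  - inner (curvature nabla x X Y (fun y => e y l)) (e x i).
Proof.
move=> sX sY; rewrite !curvatureE//.
(* Skew-symmetry of the form is available where the frame is smooth, that is near [x], which
   suffices under a derivation. *)
have sk V (v : tangent A x) : smooth_field x V ->
    v (fun y => w (V y) i l) = - v (fun y => w (V y) l i).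
  move=> sV; rewrite -(tangentN v (connection_form_smooth l i sV)).
  apply: (tangent_near_eq manA).
  have : \forall y \near x, forall j, smooth_section y (fun z => e z j).
    by apply: filter_forall => j; exact: (section_open secE (se j)).
  by apply: filterS => y sy; exact: connection_form_skew.
have quad (u v : tangent A x) : \sum_p w u i p * w v p l = \sum_p w v l p * w u p i.
  apply: eq_bigr => p _; rewrite [w u i p]connection_form_skew//.
  by rewrite [w v p l]connection_form_skew//; ring.
by rewrite (sk Y)// (sk X)// [w (lie_bracket _ _ _) _ _]connection_form_skew// !quad; ring.
Qed.

Lemma curvature_skewl X Y i l : smooth_field x X -> smooth_field x Y ->
  inner (curvature nabla x X Y (fun y => e y i)) (e x l) =
  - inner (curvature nabla x Y X (fun y => e y i)) (e x l).
Proof.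
move=> sX sY; rewrite !curvatureE// lie_bracketN// -[- lie_bracket _ _ _]scaleN1r.
by rewrite connection_formZl; ring.
Qed.

End Frame.

End Connections.

(** * The first Bianchi identity *)

Section LeviCivita.
Variables (R : realType) (n : nat) (M : topologicalType) (A : atlas R n M).
Variables (g : forall x : M, tangent A x -> tangent A x -> R).
Variable nabla : connection A (tangent_bundle g).
Hypotheses (manA : oriented_manifold A) (metg : riemannian_metric g).
Hypothesis lcM : levi_civita nabla.
Implicit Types (x y : M) (X Y Z : vector_field A).

(** Absence of torsion pairs the six second derivatives into three terms
    [nabla (U x) (lie_bracket V W)]. Each of them minus the derivative of [U] along
    [lie_bracket V W] is a double bracket, again without torsion, and the Jacobi identity ends the
    proof. *)
Lemma bianchi x X Y Z : smooth_field x X -> smooth_field x Y -> smooth_field x Z ->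
  curvature nabla x X Y Z + curvature nabla x Y Z X + curvature nabla x Z X Y = 0.
Proof.
have [metM torM] := lcM.
have tf y U V : smooth_field y U -> smooth_field y V ->
    nabla (U y) V - nabla (V y) U = lie_bracket U V y by exact: torM.
have sn y U V : smooth_field y U -> smooth_field y V ->
    smooth_field y (fun z => nabla (U z) V).
  by move=> sU sV; exact: (connection_smooth metM).
have d2 U V W : smooth_field x U -> smooth_field x V -> smooth_field x W ->
    nabla (U x) (fun y => nabla (V y) W) - nabla (U x) (fun y => nabla (W y) V)
    = nabla (U x) (lie_bracket V W).
  move=> sU sV sW; have sl := smooth_field_lie manA sV sW.
  apply/eqP; rewrite subr_eq -(connection_additive metM) //; last exact: sn.
  apply/eqP/(connection_near_eq manA metM); first exact: sn.
    by apply: smooth_fieldD => //; exact: sn.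
  have nV := smooth_field_open sV; have nW := smooth_field_open sW.
  by near=> y; rewrite -tf ?subrK//; near: y.
move=> sX sY sZ; have sXY := smooth_field_lie manA sX sY.
have sYZ := smooth_field_lie manA sY sZ; have sZX := smooth_field_lie manA sZ sX.
rewrite -(lie_bracket_jacobi manA sX sY sZ) -!tf// -!d2// /curvature.
rewrite -tf// -tf// -tf//.
apply: tangentP_eq => f _; rewrite !(tangentDE, tangentBE); ring.
Unshelve. all: by end_near. Qed.

End LeviCivita.

(** * Clifford relations *)

Lemma sum_lt_sym (V : zmodType) (n : nat) (F : 'I_n -> 'I_n -> V) :
  (forall i j, F i j = F j i) -> (forall i, F i i = 0) ->
  \sum_i \sum_j F i j = (\sum_(i < n) \sum_(j < n | (i < j)%N) F i j) *+ 2.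
Proof.
move=> symF F0; rewrite mulr2n.
transitivity (\sum_(i < n) (\sum_(j < n | (i < j)%N) F i j
                          + \sum_(j < n | (j < i)%N) F i j)).
  apply: eq_bigr => i _; rewrite (bigID (fun j : 'I_n => (i < j)%N)) /=; congr (_ + _).
  rewrite (bigD1 i) ?ltnn//= F0 add0r; apply: eq_bigl => j.
  by rewrite -leqNgt [RHS]ltn_neqAle andbC.
rewrite big_split /=; congr (_ + _); rewrite (exchange_big_dep xpredT)//=.
by apply: eq_bigr => i _; apply: eq_bigr => j _.
Qed.

(** Take the cyclic identities for the four rotations of [i j k l], the first two minus the last
    two. After normalisation by the skew-symmetries, [2 T i j k l - 2 T k l i j = 0] remains; [lra]
    finds this combination. *)
Lemma pair_symmetry (R : realFieldType) (I : Type) (T : I -> I -> I -> I -> R) :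
  (forall i j k l, T i j k l = - T j i k l) ->
  (forall i j k l, T i j k l = - T i j l k) ->
  (forall i j k l, T i j k l + T j k i l + T k i j l = 0) ->
  forall i j k l, T i j k l = T k l i j.
Proof.
move=> al ar b i j k l.
have := b i j k l; have := b j k l i; have := b k l i j; have := b l i j k.
have := al j i k l; have := ar i j k l; have := ar j i k l; have := al i j l k.
have := al k j i l; have := ar j k i l; have := ar k j i l; have := al j k l i.
have := al k i j l; have := ar k i j l; have := ar i k j l; have := al k i l j.
have := al i l j k; have := ar i l j k; have := ar l i j k; have := al i l k j.
have := al l j i k; have := ar l j i k; have := ar j l i k; have := al l j k i.
have := al k l i j; have := ar k l i j; have := ar l k i j; have := al k l j i.
have := al l i j k; have := al j l k i; have := ar j l k i.
lra.
Qed.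

Section CliffordRelations.
Variables (K : numFieldType) (B : algType K) (n : nat) (E : 'I_n -> B).
Hypothesis rel : forall i j, E i * E j + E j * E i = - (2 * (i == j)%:R)%:A.
Implicit Types (w : 'I_n -> 'I_n -> K).

Lemma sum_delta (V : lmodType K) (a : 'I_n -> K) (F : 'I_n -> V) k :
  \sum_i a i *: ((i == k)%:R *: F i) = a k *: F k.
Proof.
rewrite (bigD1 k)//= eqxx scale1r big1 ?addr0// => i ik.
by rewrite (negPf ik) scale0r scaler0.
Qed.

Lemma clifford_swap i j : E i * E j = - (E j * E i) - (2 * (i == j)%:R)%:A.
Proof. by rewrite -rel [RHS]addrC addrK. Qed.

Lemma clifford_swap_neq i j : i != j -> E i * E j = - (E j * E i).
Proof. by move=> ij; rewrite clifford_swap (negPf ij) mulr0 scale0r subr0. Qed.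

(** Moving [E k] across two generators changes the sign twice, so only the contraction terms of the
    two swaps survive. *)
Lemma clifford_comm3 i j k : E i * E j * E k - E k * (E i * E j) =
  (i == k)%:R *: (2 *: E j) - (j == k)%:R *: (2 *: E i).
Proof.
have swapA i1 j1 : (2 * (i1 == j1)%:R)%:A = (i1 == j1)%:R *: 2%:A :> B.
  by rewrite scalerA mulrC.
rewrite -mulrA [E j * E k]clifford_swap mulrBr mulrN [E i * (E k * E j)]mulrA.
rewrite [E i * E k]clifford_swap mulrBl mulNr !swapA -scalerAl -scalerAr.
rewrite -scalerAl -scalerAr mul1r mulr1 mulrA opprB opprK.
by rewrite [X in X - _]addrAC addrK.
Qed.

(** On skew-symmetric [w], the inverse of the differential of the double cover. The sum meets each
    unordered pair twice, hence [1/4] where the sum over [i < j] has [1/2]. *)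
Definition spin_lift w : B := 4^-1 *: \sum_i \sum_j w i j *: (E i * E j).

Lemma spin_liftE w : (forall i j, w i j = - w j i) ->
  \sum_(i < n) \sum_(j < n | (i < j)%N) (w i j / 2) *: (E i * E j) = spin_lift w.
Proof.
move=> skw; have w0 i : w i i = 0.
  by apply/eqP; have /eqP := skw i i; rewrite -addr_eq0 -mulr2n mulrn_eq0.
rewrite /spin_lift sum_lt_sym => [|i j|i]; last 2 first.
- have [->//|ij] := eqVneq i j.
  by rewrite (clifford_swap_neq ij) skw scaleNr scalerN opprK.
- by rewrite w0 scale0r.
rewrite -[X in _ = _ *: X]scaler_nat scalerA scaler_sumr; apply: eq_bigr => i _.
rewrite scaler_sumr; apply: eq_bigr => j _; rewrite scalerA; congr (_ *: _).
by field.
Qed.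

(** The infinitesimal form of conjugation by a spin element; this relation fixes the constant of
    [spin_lift]. *)
Lemma spin_lift_comm_gen w k : (forall i j, w i j = - w j i) ->
  spin_lift w * E k - E k * spin_lift w = \sum_j w k j *: E j.
Proof.
move=> skw; rewrite -scalerAl -scalerAr -scalerBr mulr_suml mulr_sumr -sumrB.
transitivity (4^-1 *: \sum_i \sum_j w i j *: (E i * E j * E k - E k * (E i * E j))).
  congr (_ *: _); apply: eq_bigr => i _; rewrite mulr_suml mulr_sumr -sumrB.
  by apply: eq_bigr => j _; rewrite scalerBr -scalerAl -scalerAr.
under eq_bigr do under eq_bigr do rewrite clifford_comm3 scalerBr.
under eq_bigr do rewrite sumrB.
rewrite sumrB exchange_big /=.
under eq_bigr => i _ do rewrite sum_delta.
under [X in _ - X]eq_bigr => i _ do rewrite sum_delta.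
rewrite -sumrB scaler_sumr; apply: eq_bigr => i _.
rewrite [w i k]skw scaleNr opprK -scalerDl !scalerA; congr (_ *: _).
by field.
Qed.

Definition mul_form w w' : 'I_n -> 'I_n -> K := fun i j => \sum_p w i p * w' p j.

(** The commutator with [spin_lift w] is a derivation, so its value on [E k * E l] follows from its
    values on generators. As these use the rows of [w], the matrix products appear in reverse order,
    exactly as in the structure equation [curvatureE]. *)
Lemma spin_lift_comm w w' : (forall i j, w i j = - w j i) ->
  spin_lift w * spin_lift w' - spin_lift w' * spin_lift w =
  spin_lift (fun i j => mul_form w' w i j - mul_form w w' i j).
Proof.
move=> skw; have comm k := spin_lift_comm_gen k skw.
(* From here on, [spin_lift w] is known only through its commutators with the generators. *)
rewrite /spin_lift -/(spin_lift w); move: (spin_lift w) comm => s comm.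
rewrite -scalerAl -scalerAr -scalerBr; congr (_ *: _).
rewrite mulr_suml mulr_sumr -sumrB.
transitivity (\sum_k \sum_l w' k l *:
    ((\sum_j w k j *: E j) * E l + E k * (\sum_j w l j *: E j))).
  apply: eq_bigr => k _; rewrite mulr_suml mulr_sumr -sumrB; apply: eq_bigr => l _.
  rewrite -!comm -scalerAl -scalerAr -scalerBr; congr (_ *: _).
  by rewrite mulrBl mulrBr !mulrA addrA subrK.
under eq_bigr do under eq_bigr do rewrite scalerDr.
under eq_bigr do rewrite big_split /=.
rewrite big_split /=.
under [RHS]eq_bigr do under eq_bigr do rewrite scalerBl.
under [RHS]eq_bigr do rewrite sumrB.
rewrite sumrB [LHS]addrC; congr (_ + _).
  apply: eq_bigr => k _; transitivity (\sum_l \sum_j (w' k l * w l j) *: (E k * E j)).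
    apply: eq_bigr => l _; rewrite mulr_sumr scaler_sumr; apply: eq_bigr => j _.
    by rewrite -scalerAr scalerA.
  rewrite exchange_big /=; apply: eq_bigr => j _.
  by rewrite -scaler_suml.
transitivity (\sum_k \sum_l \sum_j (w' k l * w k j) *: (E j * E l)).
  apply: eq_bigr => k _; apply: eq_bigr => l _; rewrite mulr_suml scaler_sumr.
  by apply: eq_bigr => j _; rewrite -scalerAl scalerA.
under eq_bigr do rewrite exchange_big /=.
rewrite exchange_big /= -sumrN; apply: eq_bigr => j _.
rewrite exchange_big /= -sumrN; apply: eq_bigr => l _.
rewrite -scaler_suml -scaleNr; congr (_ *: _); rewrite -sumrN.
by apply: eq_bigr => k _; rewrite [w k j]skw mulrN mulrC.
Qed.

(** * Contraction of curvature tensors with Clifford generators *)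

Section Contraction.
Variable T : 'I_n -> 'I_n -> 'I_n -> 'I_n -> K.
Hypothesis skewl : forall i j k l, T i j k l = - T j i k l.
Hypothesis cyclic : forall i j k l, T i j k l + T j k i l + T k i j l = 0.
Hypothesis ricci_sym : forall i l, \sum_j T i j j l = \sum_j T l j j i.

Let T0 i k l : T i i k l = 0.
Proof. by apply/eqP; have /eqP := skewl i i k l; rewrite -addr_eq0 -mulr2n mulrn_eq0. Qed.

Section Triple.
Variable l : 'I_n.
Let tsum (F : 'I_n -> 'I_n -> 'I_n -> B) := \sum_i \sum_j \sum_k T i j k l *: F i j k.
Let ricci := \sum_i \sum_j T i j j l *: E i.

Let tsumD F G : tsum (fun i j k => F i j k + G i j k) = tsum F + tsum G.
Proof.
rewrite /tsum -big_split; apply: eq_bigr => i _ /=.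
rewrite -big_split; apply: eq_bigr => j _ /=.
by rewrite -big_split; apply: eq_bigr => k _ /=; rewrite scalerDr.
Qed.

Let tsumN F : tsum (fun i j k => - F i j k) = - tsum F.
Proof.
rewrite /tsum -sumrN; apply: eq_bigr => i _; rewrite -sumrN; apply: eq_bigr => j _.
by rewrite -sumrN; apply: eq_bigr => k _; rewrite scalerN.
Qed.

Let tsum_jk : tsum (fun i j k => (j == k)%:R *: (2 *: E i)) = 2 *: ricci.
Proof.
rewrite /tsum /ricci scaler_sumr; apply: eq_bigr => i _.
rewrite scaler_sumr; apply: eq_bigr => j _.
under eq_bigr do rewrite eq_sym.
by rewrite sum_delta !scalerA mulrC.
Qed.

Let tsum_ik : tsum (fun i j k => (i == k)%:R *: (2 *: E j)) = - (2 *: ricci).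
Proof.
rewrite /tsum /ricci exchange_big /= scaler_sumr -sumrN; apply: eq_bigr => j _.
rewrite scaler_sumr -sumrN; apply: eq_bigr => i _.
under eq_bigr do rewrite eq_sym.
by rewrite sum_delta skewl scaleNr !scalerA mulrC.
Qed.

Let tsum_ij : tsum (fun i j k => (j == i)%:R *: (2 *: E k)) = 0.
Proof.
rewrite /tsum big1// => i _; rewrite exchange_big big1//= => k _.
by rewrite sum_delta T0 scale0r.
Qed.

(* Sum the cyclic identity against [E i * E j * E k] and move the three products
   back to this order: the left-hand side occurs three times, and what is left
   over is Ricci terms. *)
Lemma contraction3 : \sum_i \sum_j \sum_k T i j k l *: (E i * E j * E k) =
  - (2 *: \sum_i \sum_j T i j j l *: E i).
Proof.
rewrite -/ricci; set Q := LHS.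
have Q2 : \sum_i \sum_j \sum_k T j k i l *: (E i * E j * E k) =
    Q + 2 *: ricci + 2 *: ricci.
  rewrite exchange_big /=; under eq_bigr do rewrite exchange_big /=.
  transitivity (tsum (fun i j k => E i * E j * E k - (i == k)%:R *: (2 *: E j)
      + (j == k)%:R *: (2 *: E i))).
    apply: eq_bigr => i _; apply: eq_bigr => j _; apply: eq_bigr => k _.
    congr (_ *: _); rewrite -[RHS]addrA [- _ + _]addrC -opprB -clifford_comm3 opprB.
    by rewrite [RHS]addrC subrK mulrA.
  by rewrite tsumD (tsumD (fun i j k => E i * E j * E k)) tsumN tsum_ik tsum_jk opprK.
have Q3 : \sum_i \sum_j \sum_k T k i j l *: (E i * E j * E k) = Q + 2 *: ricci.
  under eq_bigr do rewrite exchange_big /=.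
  rewrite exchange_big /=.
  transitivity (tsum (fun i j k => E i * E j * E k + ((j == i)%:R *: (2 *: E k)
      - (k == i)%:R *: (2 *: E j)))).
    apply: eq_bigr => i _; apply: eq_bigr => j _; apply: eq_bigr => k _.
    by congr (_ *: _); rewrite -clifford_comm3 mulrA addrC subrK.
  rewrite tsumD tsumD tsum_ij add0r tsumN; congr (_ + _).
  by rewrite -[RHS]opprK -tsum_ik /tsum; under eq_bigr do under eq_bigr do
    under eq_bigr do rewrite eq_sym.
have : Q + (Q + 2 *: ricci + 2 *: ricci) + (Q + 2 *: ricci) = 0.
  rewrite -{1}Q2 -Q3 /Q -!big_split big1//= => i _.
  rewrite -!big_split big1//= => j _; rewrite -!big_split big1//= => k _.
  by rewrite -!scalerDl cyclic scale0r.
have -> : Q + (Q + 2 *: ricci + 2 *: ricci) + (Q + 2 *: ricci) = 3 *: (Q + 2 *: ricci).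
  move: (2 *: ricci) => a; rewrite scaler_nat !mulrS mulr0n addr0 !addrA; congr (_ + _ + _ + _).
  by rewrite addrAC.
move=> /eqP; rewrite scaler_eq0 pnatr_eq0 /= addr_eq0 => /eqP //.
Qed.

End Triple.

Lemma curvature_contraction :
  \sum_(i < n) \sum_(j < n | (i < j)%N) E i * E j * spin_lift (T i j) =
  (4^-1 * \sum_i \sum_j T i j j i)%:A.
Proof.
set L := LHS; apply: (@scalerI _ _ 2); first by rewrite pnatr_eq0.
pose ric i l := \sum_j T i j j l.
have -> : 2 *: L = \sum_i \sum_j E i * E j * spin_lift (T i j).
  rewrite scaler_nat sum_lt_sym// => [i j|i].
    have [->//|ij] := eqVneq i j.
    rewrite (clifford_swap_neq ij) mulNr -mulrN -scaleN1r /spin_lift scalerA mulrC -scalerA.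
    congr (_ * (_ *: _)); rewrite scaler_sumr; apply: eq_bigr => k _.
    rewrite scaler_sumr; apply: eq_bigr => l _.
    by rewrite scalerA mulN1r -skewl.
  rewrite /spin_lift big1 ?scaler0 ?mulr0// => k _; rewrite big1// => l _.
  by rewrite T0 scale0r.
(* The last index is set apart, so that for each [l] the inner triple sum is the one of
   [contraction3]. *)
transitivity (4^-1 *: \sum_l (\sum_i \sum_j \sum_k T i j k l *: (E i * E j * E k)) * E l).
  rewrite /spin_lift; under eq_bigr do under eq_bigr do rewrite -scalerAr.
  under eq_bigr do rewrite -scaler_sumr.
  rewrite -scaler_sumr; congr (_ *: _); apply/esym.
  under eq_bigr do rewrite mulr_suml.
  rewrite exchange_big; apply: eq_bigr => i _ /=.
  under eq_bigr do rewrite mulr_suml.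
  rewrite exchange_big; apply: eq_bigr => j _ /=.
  under eq_bigr do rewrite mulr_suml.
  rewrite exchange_big mulr_sumr; apply: eq_bigr => k _ /=.
  rewrite mulr_sumr; apply: eq_bigr => l _.
  by rewrite -scalerAl -scalerAr mulrA.
(* By symmetry of the Ricci tensor, twice the sum involves only anticommutators of generators, and
   these leave just the trace. *)
have ricE : \sum_l (\sum_i ric i l *: E i) * E l = - (\sum_i ric i i)%:A.
  apply: (@scalerI _ _ 2); first by rewrite pnatr_eq0.
  rewrite [LHS]scaler_nat mulr2n.
  transitivity (\sum_l \sum_i ric i l *: (E i * E l + E l * E i)).
    under [RHS]eq_bigr do under eq_bigr do rewrite scalerDr.
    under [RHS]eq_bigr do rewrite big_split /=.
    rewrite [RHS]big_split /=; congr (_ + _).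
      apply: eq_bigr => l _; rewrite mulr_suml; apply: eq_bigr => i _.
      by rewrite -scalerAl.
    rewrite [RHS]exchange_big /=.
    apply: eq_bigr => l _; rewrite mulr_suml; apply: eq_bigr => i _.
    by rewrite -scalerAl /ric ricci_sym.
  rewrite scalerN scalerA mulr_sumr scaler_suml -sumrN.
  apply: eq_bigr => l _; under eq_bigr do rewrite rel.
  rewrite (bigD1 l)//= eqxx big1 ?addr0 => [|i il].
    by rewrite mulr1 scalerN scalerA mulrC.
  by rewrite (negPf il) mulr0 scale0r oppr0 scaler0.
under eq_bigr do rewrite contraction3 -scalerN -scalerAl.
rewrite -scaler_sumr.
under eq_bigr do under eq_bigr do rewrite -scaler_suml.
under eq_bigr do rewrite mulNr.
rewrite sumrN ricE opprK !scalerA; congr (_ *: _).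
by rewrite /ric; field.
Qed.

End Contraction.
End CliffordRelations.

(** * Twisted spinors *)

Section TensorPowerAction.
Variable K : comNzRingType.

Lemma tensmxDl (m n p q : nat) (a b : 'M[K]_(m, n)) (c : 'M[K]_(p, q)) :
  tensmx (a + b) c = tensmx a c + tensmx b c.
Proof. by apply/matrixP => i j; rewrite !mxE mulrDl. Qed.

Lemma tensmxDr (m n p q : nat) (a : 'M[K]_(m, n)) (b c : 'M[K]_(p, q)) :
  tensmx a (b + c) = tensmx a b + tensmx a c.
Proof. by apply/matrixP => i j; rewrite !mxE mulrDr. Qed.

Lemma tensmxZl (m n p q : nat) x (a : 'M[K]_(m, n)) (b : 'M[K]_(p, q)) :
  tensmx (x *: a) b = x *: tensmx a b.
Proof. by apply/matrixP => i j; rewrite !mxE mulrA. Qed.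

Lemma tensmxZr (m n p q : nat) x (a : 'M[K]_(m, n)) (b : 'M[K]_(p, q)) :
  tensmx a (x *: b) = x *: tensmx a b.
Proof. by apply/matrixP => i j; rewrite !mxE mulrCA. Qed.

Lemma tensmx11 (p q : nat) : tensmx (1%:M : 'M[K]_p) (1%:M : 'M[K]_q) = 1%:M.
Proof.
apply/matrixP => i j; case: (mxtens_indexP i) => i0 i1.
case: (mxtens_indexP j) => j0 j1; rewrite tensmxE !mxE (can_eq (@mxtens_indexK _ _)).
by rewrite -natrM mulnb.
Qed.

(** The recursion splits off a tensor factor only from two factors on, [dtensmx a 1] being [a]
    itself. Hence the inductions below treat [m = 0] apart and start at [m = 1]. *)
Lemma dtensmxSS (d m : nat) (a : 'M[K]_d) : dtensmx a m.+2 =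
  tensmx a (1%:M : 'M[K]_(d ^ m.+1)) + tensmx (1%:M : 'M[K]_d) (dtensmx a m.+1).
Proof. by []. Qed.

Lemma dtensmx_linear (d m : nat) x (a b : 'M[K]_d) :
  dtensmx (x *: a + b) m = x *: dtensmx a m + dtensmx b m.
Proof.
case: m => [|m]; first by rewrite scaler0 addr0.
elim: m => [//|m IHm]; rewrite !dtensmxSS IHm.
by rewrite tensmxDl tensmxDr tensmxZl tensmxZr scalerDr addrACA.
Qed.

(** Endomorphisms of different tensor factors commute, so only the brackets within each factor
    remain. *)
Lemma dtensmx_comm (d m : nat) (a b : 'M[K]_d) :
  dtensmx a m *m dtensmx b m - dtensmx b m *m dtensmx a m =
  dtensmx (a *m b - b *m a) m.
Proof.
case: m => [|m]; first by rewrite !mul0mx subr0.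
elim: m => [//|m IHm]; rewrite !dtensmxSS -IHm.
rewrite !mulmxDl !mulmxDr !tensmx_mul !mulmx1 !mul1mx.
rewrite -![in RHS]scaleN1r.
rewrite tensmxDl tensmxDr tensmxZl tensmxZr !scaleN1r.
by apply/matrixP => i j; rewrite !mxE; ring.
Qed.

End TensorPowerAction.

(** * Clifford multiplication and the twist action as linear families of matrices *)

Section SpinorOperators.
Variables (R : realType) (n r m : nat).
Variables (kappan : clifford_rep R n) (kappar : clifford_rep R r).
Local Notation C := R[i].
Local Notation S := (spinor R n r m).
Local Notation op := 'M[C]_(2 ^ n./2 * (2 ^ r./2) ^ m).

Definition vector_op (a : clifford C n) : op := tensmx (kappan a) 1%:M.

Definition twist_op (b : clifford C r) : op := tensmx 1%:M (dtensmx (kappar b) m).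

Let vector_op_linear : linear vector_op.
Proof. by move=> x a b; rewrite /vector_op linearP tensmxDl tensmxZl. Qed.

HB.instance Definition _ := GRing.isLinear.Build C (clifford C n) op *:%R
  vector_op vector_op_linear.

Let twist_op_linear : linear twist_op.
Proof. by move=> x a b; rewrite /twist_op linearP dtensmx_linear tensmxDr tensmxZr. Qed.

HB.instance Definition _ := GRing.isLinear.Build C (clifford C r) op *:%R
  twist_op twist_op_linear.

Lemma vector_opM a b : vector_op (a * b) = vector_op a *m vector_op b.
Proof. by rewrite /vector_op rmorphM tensmx_mul mulmx1. Qed.

Lemma vector_op_scalar c : vector_op c%:A = c%:M.
Proof. by rewrite /vector_op linearZ /= rmorph1 tensmxZl tensmx11 scalemx1. Qed.

Lemma twist_op_comm a b :
  twist_op a *m twist_op b - twist_op b *m twist_op a = twist_op (a * b - b * a).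
Proof.
rewrite /twist_op !tensmx_mul !mulmx1 rmorphB !rmorphM -dtensmx_comm.
by rewrite -scaleN1r -tensmxZr -tensmxDr scaleN1r.
Qed.

Lemma vector_twist_comm a b : vector_op a *m twist_op b = twist_op b *m vector_op a.
Proof. by rewrite /vector_op /twist_op !tensmx_mul !mulmx1 !mul1mx. Qed.

Lemma complexify_gen k (i : 'I_k) : complexify (clifford_gen R i) = clifford_gen C i.
Proof. by apply/ffunP => a; rewrite !ffunE; case: (a == _). Qed.

Lemma complexify_gen2 k (i j : 'I_k) :
  complexify (clifford_gen R i * clifford_gen R j) = clifford_gen C i * clifford_gen C j.
Proof.
rewrite /clifford_gen !clifford_basis_mul; apply/ffunP => a; rewrite !ffunE rmorphM.
congr (_ * _); last by case: (a == _).
rewrite /clifford_sign rmorph_prod; apply: eq_bigr => l _.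
by rewrite rmorph_prod; apply: eq_bigr => p _; rewrite rmorphXn rmorphN1.
Qed.

Lemma clifford_act1E i (u : S) :
  clifford_act kappan (clifford_gen R i) u = vector_op (clifford_gen C i) *m u.
Proof. by rewrite /clifford_act complexify_gen. Qed.

Lemma clifford_act2E i j (u : S) :
  clifford_act kappan (clifford_gen R i * clifford_gen R j) u =
  vector_op (clifford_gen C i * clifford_gen C j) *m u.
Proof. by rewrite /clifford_act complexify_gen2. Qed.

Lemma twist_act2E i j (u : S) :
  twist_act kappar (clifford_gen R i * clifford_gen R j) u =
  twist_op (clifford_gen C i * clifford_gen C j) *m u.
Proof. by rewrite /twist_act complexify_gen2. Qed.

End SpinorOperators.

(** * Calculus of complex functions and of spinor fields *)

Section ComplexFunctions.
Variables (R : realType) (n : nat) (M : topologicalType) (A : atlas R n M).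
Hypothesis manA : oriented_manifold A.
Local Notation C := R[i].
Implicit Types (x y : M) (h : M -> C) (X Y : vector_field A).

Let ReD (a b : C) : complex.Re (a + b) = complex.Re a + complex.Re b.
Proof. by case: a b => [a1 a2] [b1 b2]. Qed.

Let ImD (a b : C) : complex.Im (a + b) = complex.Im a + complex.Im b.
Proof. by case: a b => [a1 a2] [b1 b2]. Qed.

Let ReM (a b : C) : complex.Re (a * b) =
  complex.Re a * complex.Re b - complex.Im a * complex.Im b.
Proof. by case: a b => [a1 a2] [b1 b2]. Qed.

Let ImM (a b : C) : complex.Im (a * b) =
  complex.Re a * complex.Im b + complex.Im a * complex.Re b.
Proof. by case: a b => [a1 a2] [b1 b2]. Qed.

Definition csmooth x h := smooth_near A x (fun y => complex.Re (h y)) /\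
  smooth_near A x (fun y => complex.Im (h y)).

(** The complex-linear extension of a tangent vector, which by itself differentiates real functions
    only. *)
Definition cderiv x (v : tangent A x) h : C :=
  (v (fun y => complex.Re (h y)) +i* v (fun y => complex.Im (h y)))%C.

Lemma csmooth_real x (f : M -> R) : smooth_near A x f -> csmooth x (fun y => (f y)%:C).
Proof. by move=> sf; split => //; exact: smooth_near_cst. Qed.

Lemma csmooth_cst x (a : C) : csmooth x (fun=> a).
Proof. by split; exact: smooth_near_cst. Qed.

Lemma csmoothD x h1 h2 : csmooth x h1 -> csmooth x h2 -> csmooth x (fun y => h1 y + h2 y).
Proof.
move=> [r1 i1] [r2 i2]; split; [under eq_fun do rewrite ReD|under eq_fun do rewrite ImD];
  exact: smooth_nearD.
Qed.

Lemma csmoothM x h1 h2 : csmooth x h1 -> csmooth x h2 -> csmooth x (fun y => h1 y * h2 y).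
Proof.
move=> [r1 i1] [r2 i2]; split; [under eq_fun do rewrite ReM|under eq_fun do rewrite ImM].
  by apply: smooth_nearB => //; exact: smooth_nearM.
by apply: smooth_nearD => //; exact: smooth_nearM.
Qed.

Lemma cderivD x (v : tangent A x) h1 h2 : csmooth x h1 -> csmooth x h2 ->
  cderiv v (fun y => h1 y + h2 y) = cderiv v h1 + cderiv v h2.
Proof.
move=> [r1 i1] [r2 i2]; rewrite /cderiv.
under eq_fun do rewrite ReD; under [X in (_ +i* v X)%C]eq_fun do rewrite ImD.
by rewrite !tangentD.
Qed.

Lemma cderivM x (v : tangent A x) h1 h2 : csmooth x h1 -> csmooth x h2 ->
  cderiv v (fun y => h1 y * h2 y) = cderiv v h1 * h2 x + h1 x * cderiv v h2.
Proof.
move=> [r1 i1] [r2 i2]; rewrite /cderiv.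
under eq_fun do rewrite ReM; under [X in (_ +i* v X)%C]eq_fun do rewrite ImM.
rewrite tangentB ?tangentD ?tangentM//; try exact: smooth_nearM.
case: (h1 x) (h2 x) => [a b] [c d]; apply/eqP; rewrite eq_complex /=.
by apply/andP; split; apply/eqP; ring.
Qed.

Lemma cderiv_real x (v : tangent A x) (f : M -> R) :
  cderiv v (fun y => (f y)%:C) = (v f)%:C.
Proof. by rewrite /cderiv /= tangent_cst. Qed.

Lemma cderiv_cst x (v : tangent A x) (a : C) : cderiv v (fun=> a) = 0.
Proof. by rewrite /cderiv /= !tangent_cst. Qed.

Lemma csmooth_sum (I : Type) (s : seq I) x (h : I -> M -> C) :
  (forall i, csmooth x (h i)) -> csmooth x (fun y => \sum_(i <- s) h i y).
Proof.
move=> sh; elim: s => [|i s IHs].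
  by under eq_fun do rewrite big_nil; exact: csmooth_cst.
by under eq_fun do rewrite big_cons; exact: csmoothD.
Qed.

Lemma cderiv_sum (I : Type) (s : seq I) x (v : tangent A x) (h : I -> M -> C) :
  (forall i, csmooth x (h i)) ->
  cderiv v (fun y => \sum_(i <- s) h i y) = \sum_(i <- s) cderiv v (h i).
Proof.
move=> sh; elim: s => [|i s IHs].
  by under eq_fun do rewrite big_nil; rewrite big_nil cderiv_cst.
under eq_fun do rewrite big_cons; rewrite big_cons cderivD ?IHs//.
exact: csmooth_sum.
Qed.

Lemma csmooth_eq x h1 h2 : (\forall y \near x, h1 y = h2 y) -> csmooth x h1 -> csmooth x h2.
Proof.
move=> h12 [r i]; split; [apply: (smooth_near_eq manA) r|apply: (smooth_near_eq manA) i];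
  by apply: filterS h12 => y ->.
Qed.

Lemma cderiv_near_eq x (v : tangent A x) h1 h2 : (\forall y \near x, h1 y = h2 y) ->
  cderiv v h1 = cderiv v h2.
Proof.
move=> h12; rewrite /cderiv; congr (_ +i* _)%C;
  by apply: (tangent_near_eq manA); apply: filterS h12 => y ->.
Qed.

Lemma cderivZl x a (v : tangent A x) h : cderiv (a *: v) h = a%:C * cderiv v h.
Proof.
rewrite /cderiv !tangentZE; apply/eqP; rewrite eq_complex /=.
by apply/andP; split; apply/eqP; ring.
Qed.

Lemma csmooth_field x X h : smooth_field x X -> csmooth x h ->
  csmooth x (fun y => cderiv (X y) h).
Proof. by move=> sX [sr si]; split; exact: smooth_field_apply. Qed.

Lemma cderiv_lie x X Y h : smooth_field x X -> smooth_field x Y -> csmooth x h ->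
  cderiv (lie_bracket X Y x) h =
  cderiv (X x) (fun y => cderiv (Y y) h) - cderiv (Y x) (fun y => cderiv (X y) h).
Proof. by move=> sX sY [sr si]; rewrite /cderiv !lie_bracketE. Qed.

End ComplexFunctions.

Section SpinorFields.
Variables (R : realType) (n r m : nat) (M : topologicalType) (A : atlas R n M).
Hypothesis manA : oriented_manifold A.
Local Notation C := R[i].
Local Notation S := (spinor R n r m).
Local Notation op := 'M[C]_(2 ^ n./2 * (2 ^ r./2) ^ m).
Implicit Types (x y : M) (psi : M -> S) (X Y : vector_field A) (b : op).

Definition smooth_spinor x psi := forall c, csmooth A x (fun y => psi y c 0).

Lemma spinor_derivativeE x (v : tangent A x) psi c :
  spinor_derivative v psi c 0 = cderiv v (fun y => psi y c 0).
Proof. by rewrite mxE. Qed.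

Lemma smooth_spinor_eq x psi1 psi2 : (\forall y \near x, psi1 y = psi2 y) ->
  smooth_spinor x psi1 -> smooth_spinor x psi2.
Proof.
by move=> e s c; apply: (csmooth_eq manA) (s c); apply: filterS e => y ->.
Qed.

Lemma spinor_derivative_near_eq x (v : tangent A x) psi1 psi2 :
  (\forall y \near x, psi1 y = psi2 y) ->
  spinor_derivative v psi1 = spinor_derivative v psi2.
Proof.
move=> e; apply/colP => c; rewrite !spinor_derivativeE.
by apply: (cderiv_near_eq manA); apply: filterS e => y ->.
Qed.

Lemma smooth_spinorD x psi1 psi2 : smooth_spinor x psi1 -> smooth_spinor x psi2 ->
  smooth_spinor x (fun y => psi1 y + psi2 y).
Proof.
by move=> s1 s2 c; under eq_fun do rewrite mxE; exact: csmoothD.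
Qed.

Lemma spinor_derivativeD x (v : tangent A x) psi1 psi2 :
  smooth_spinor x psi1 -> smooth_spinor x psi2 ->
  spinor_derivative v (fun y => psi1 y + psi2 y) =
  spinor_derivative v psi1 + spinor_derivative v psi2.
Proof.
move=> s1 s2; apply/colP => c; rewrite [RHS]mxE !spinor_derivativeE.
by under eq_fun do rewrite mxE; rewrite cderivD.
Qed.

Lemma smooth_spinor0 x : smooth_spinor x (fun=> 0).
Proof. by move=> c; under eq_fun do rewrite mxE; exact: csmooth_cst. Qed.

Lemma spinor_derivative0 x (v : tangent A x) : spinor_derivative v (fun=> 0 : S) = 0.
Proof.
apply/colP => c; rewrite [RHS]mxE spinor_derivativeE.
by under eq_fun do rewrite mxE; rewrite cderiv_cst.
Qed.

Lemma smooth_spinor_sum (I : Type) (s : seq I) x (psi : I -> M -> S) :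
  (forall i, smooth_spinor x (psi i)) ->
  smooth_spinor x (fun y => \sum_(i <- s) psi i y).
Proof.
move=> sp; elim: s => [|i s IHs].
  by under eq_fun do rewrite big_nil; exact: smooth_spinor0.
by under eq_fun do rewrite big_cons; exact: smooth_spinorD.
Qed.

Lemma spinor_derivative_sum (I : Type) (s : seq I) x (v : tangent A x)
    (psi : I -> M -> S) : (forall i, smooth_spinor x (psi i)) ->
  spinor_derivative v (fun y => \sum_(i <- s) psi i y) =
  \sum_(i <- s) spinor_derivative v (psi i).
Proof.
move=> sp; elim: s => [|i s IHs].
  by under eq_fun do rewrite big_nil; rewrite big_nil spinor_derivative0.
under eq_fun do rewrite big_cons; rewrite big_cons spinor_derivativeD ?IHs//.
exact: smooth_spinor_sum.
Qed.

Lemma smooth_spinorZ x (f : M -> R) psi : smooth_near A x f -> smooth_spinor x psi ->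
  smooth_spinor x (fun y => (f y)%:C *: psi y).
Proof.
move=> sf sp c; under eq_fun do rewrite mxE.
by apply: csmoothM => //; exact: csmooth_real.
Qed.

Lemma spinor_derivativeZ x (v : tangent A x) (f : M -> R) psi :
  smooth_near A x f -> smooth_spinor x psi ->
  spinor_derivative v (fun y => (f y)%:C *: psi y) =
  (v f)%:C *: psi x + (f x)%:C *: spinor_derivative v psi.
Proof.
move=> sf sp; apply/colP => c; rewrite spinor_derivativeE.
under eq_fun do rewrite mxE.
rewrite (cderivM manA)//; last exact: csmooth_real.
by rewrite cderiv_real [RHS]mxE ![in RHS]mxE.
Qed.

Lemma smooth_spinor_mul x b psi : smooth_spinor x psi ->
  smooth_spinor x (fun y => b *m psi y).
Proof.
move=> sp c; under eq_fun do rewrite mxE.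
by apply: csmooth_sum => // i; apply: csmoothM => //; exact: csmooth_cst.
Qed.

Lemma spinor_derivative_mul x (v : tangent A x) b psi : smooth_spinor x psi ->
  spinor_derivative v (fun y => b *m psi y) = b *m spinor_derivative v psi.
Proof.
move=> sp; apply/colP => c; rewrite spinor_derivativeE.
under eq_fun do rewrite mxE.
rewrite (cderiv_sum manA) => [|i]; last by apply: csmoothM => //; exact: csmooth_cst.
rewrite [RHS]mxE; apply: eq_bigr => i _.
rewrite (cderivM manA)//; last exact: csmooth_cst.
by rewrite cderiv_cst mul0r add0r; congr (_ * _); rewrite -spinor_derivativeE.
Qed.

Lemma spinor_derivativeDl x (u v : tangent A x) psi :
  spinor_derivative (u + v) psi = spinor_derivative u psi + spinor_derivative v psi.
Proof. by apply/colP => c; rewrite !mxE. Qed.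

Lemma spinor_derivativeZl x a (v : tangent A x) psi :
  spinor_derivative (a *: v) psi = a%:C *: spinor_derivative v psi.
Proof.
apply/colP => c; rewrite spinor_derivativeE cderivZl [RHS]mxE.
by congr (_ * _); rewrite -spinor_derivativeE.
Qed.

Lemma smooth_spinor_field x X psi : smooth_field x X -> smooth_spinor x psi ->
  smooth_spinor x (fun y => spinor_derivative (X y) psi).
Proof. by move=> sX sp c; under eq_fun do rewrite mxE; exact: csmooth_field. Qed.

Lemma spinor_derivative_lie x X Y psi : smooth_field x X -> smooth_field x Y ->
  smooth_spinor x psi -> spinor_derivative (lie_bracket X Y x) psi =
  spinor_derivative (X x) (fun y => spinor_derivative (Y y) psi)
  - spinor_derivative (Y x) (fun y => spinor_derivative (X y) psi).
Proof.
move=> sX sY sp; apply/colP => c; rewrite spinor_derivativeE (cderiv_lie manA)//.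
rewrite !mxE; congr (_ - _); rewrite /cderiv; congr (_ +i* _)%C;
  by congr (tangent_val _ _); apply/funext => y; rewrite !mxE.
Qed.

(* The lift of the so(k)-valued form [w] to the Lie algebra of Spin(k). *)
Definition lift_form k (w : 'I_k -> 'I_k -> R) : clifford C k :=
  spin_lift (@clifford_gen C k) (fun i j => (w i j)%:C).

Lemma lift_formD k (w w' : 'I_k -> 'I_k -> R) :
  lift_form (fun i j => w i j + w' i j) = lift_form w + lift_form w'.
Proof.
rewrite /lift_form /spin_lift -scalerDr -big_split; congr (_ *: _).
apply: eq_bigr => i _; rewrite -big_split; apply: eq_bigr => j _ /=.
by rewrite rmorphD scalerDl.
Qed.

Lemma lift_formZ k a (w : 'I_k -> 'I_k -> R) :
  lift_form (fun i j => a * w i j) = a%:C *: lift_form w.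
Proof.
rewrite /lift_form /spin_lift [RHS]scalerA mulrC -scalerA; congr (_ *: _).
rewrite scaler_sumr.
apply: eq_bigr => i _; rewrite scaler_sumr; apply: eq_bigr => j _.
by rewrite scalerA rmorphM.
Qed.

Lemma lift_formB k (w w' : 'I_k -> 'I_k -> R) :
  lift_form (fun i j => w i j - w' i j) = lift_form w - lift_form w'.
Proof.
rewrite -[in RHS]scaleN1r -[-1 in RHS](rmorphN1 (real_complex R)) -lift_formZ -lift_formD.
by congr lift_form; apply/funext => i; apply/funext => j; rewrite mulN1r.
Qed.

Lemma lift_form_comm k (w w' : 'I_k -> 'I_k -> R) : (forall i j, w i j = - w j i) ->
  lift_form w * lift_form w' - lift_form w' * lift_form w =
  lift_form (fun i j => \sum_p w' i p * w p j - \sum_p w i p * w' p j).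
Proof.
move=> skw; rewrite (spin_lift_comm (@clifford_gen_rel C k)) => [|i j]; last first.
  by rewrite skw rmorphN.
congr spin_lift; apply/funext => i; apply/funext => j.
rewrite rmorphB !rmorph_sum /mul_form; congr (_ - _);
  by apply: eq_bigr => p _; rewrite rmorphM.
Qed.

(** Separates the real coefficients, which vary with the point, from constant matrices, so that the
    rules for scalar multiples and constant matrices give the smoothness and the derivative of the
    connection terms. *)
Lemma lift_form_mulE k (L : {linear clifford C k -> op}) (w : 'I_k -> 'I_k -> R)
    (u : S) : L (lift_form w) *m u =
  \sum_i \sum_j (w i j)%:C *:
    ((4^-1 *: L (clifford_gen C i * clifford_gen C j)) *m u).
Proof.
rewrite /lift_form /spin_lift linearZ_LR linear_sum scaler_sumr mulmx_suml.
apply: eq_bigr => i _; rewrite linear_sum scaler_sumr mulmx_suml.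
apply: eq_bigr => j _; rewrite linearZ_LR scalerA mulrC -scalerA.
exact/esym/scalemxAl.
Qed.

Lemma smooth_spinor_lift k (L : {linear clifford C k -> op}) x
    (w : M -> 'I_k -> 'I_k -> R) psi :
  (forall i j, smooth_near A x (fun y => w y i j)) -> smooth_spinor x psi ->
  smooth_spinor x (fun y => L (lift_form (w y)) *m psi y).
Proof.
move=> sw sp; under eq_fun do rewrite lift_form_mulE.
do 2!apply: smooth_spinor_sum => ?.
by apply: smooth_spinorZ => //; exact: smooth_spinor_mul.
Qed.

Lemma spinor_derivative_lift k (L : {linear clifford C k -> op}) x
    (v : tangent A x) (w : M -> 'I_k -> 'I_k -> R) psi :
  (forall i j, smooth_near A x (fun y => w y i j)) -> smooth_spinor x psi ->
  spinor_derivative v (fun y => L (lift_form (w y)) *m psi y) =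
  L (lift_form (fun i j => v (fun y => w y i j))) *m psi x
  + L (lift_form (w x)) *m spinor_derivative v psi.
Proof.
move=> sw sp; under eq_fun do rewrite lift_form_mulE.
have sb b : smooth_spinor x (fun y => b *m psi y) by exact: smooth_spinor_mul.
rewrite spinor_derivative_sum => [|i]; last first.
  by apply: smooth_spinor_sum => j; exact: smooth_spinorZ.
rewrite [X in _ = X + _]lift_form_mulE [X in _ = _ + X]lift_form_mulE -big_split.
apply: eq_bigr => i _ /=.
rewrite spinor_derivative_sum => [|j]; last exact: smooth_spinorZ.
rewrite -big_split; apply: eq_bigr => j _ /=.
by rewrite spinor_derivativeZ// spinor_derivative_mul.
Qed.

End SpinorFields.

(** * Matrix identities behind the curvature and the square of the Dirac operator *)

Section ConnectionAlgebra.
Variables (K : comPzRingType) (N : nat).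
Implicit Types (o t : 'M[K]_N) (u d : 'cV[K]_N).

Lemma commute_connection_form o t b u d : b *m t = t *m b ->
  b *m d + o *m (b *m u) + t *m (b *m u) =
  b *m (d + o *m u + t *m u) + (o *m b - b *m o) *m u.
Proof.
move=> bt; rewrite !mulmxDr mulmxBl !mulmxA -bt.
move: (b *m d) (o *m b *m u) (b *m o *m u) (b *m t *m u) => p1 p2 p3 p4.
by apply/colP => i; rewrite !mxE; ring.
Qed.

(** Here [o1], [o2] and [t1], [t2] stand for the lifted forms of [TM] and [F] along two fields, [o]
    and [t] for those along the bracket, [o12] for a derivative of a form, and the [d] for
    derivatives of the spinor. Products of a form with a first derivative cancel in the difference,
    and products of an [o] with a [t] cancel because these commute. *)
Lemma commute_connections o1 t1 o2 t2 o12 t12 o21 t21 o t u d1 d2 d12 d21 :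
  o1 *m t2 = t2 *m o1 -> o2 *m t1 = t1 *m o2 ->
  d12 + (o12 *m u + o2 *m d1) + (t12 *m u + t2 *m d1)
    + o1 *m (d2 + o2 *m u + t2 *m u) + t1 *m (d2 + o2 *m u + t2 *m u)
  - (d21 + (o21 *m u + o1 *m d2) + (t21 *m u + t1 *m d2)
    + o2 *m (d1 + o1 *m u + t1 *m u) + t2 *m (d1 + o1 *m u + t1 *m u)) =
  d12 - d21 + o *m u + t *m u
  + ((o12 - o21 - o + (o1 *m o2 - o2 *m o1)) *m u
     + (t12 - t21 - t + (t1 *m t2 - t2 *m t1)) *m u).
Proof.
move=> c12 c21; rewrite !mulmxDr !mulmxDl !mulNmx !mulmxA c12 c21.
move: (o1 *m d2) (t1 *m d2) (o2 *m d1) (t2 *m d1) => p1 p2 p3 p4.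
move: (o *m u) (t *m u) (o12 *m u) (o21 *m u) (t12 *m u) (t21 *m u) => q1 q2 q3 q4 q5 q6.
move: (o1 *m o2 *m u) (o2 *m o1 *m u) (t1 *m t2 *m u) (t2 *m t1 *m u) => r1 r2 r3 r4.
move: (t2 *m o1 *m u) (t1 *m o2 *m u) => r5 r6.
by apply/colP => i; rewrite !mxE; ring.
Qed.

End ConnectionAlgebra.

Lemma dirac_square (K : comPzRingType) (N n : nat) (E : 'I_n -> 'M[K]_N)
    (u : 'I_n -> 'I_n -> 'cV[K]_N) :
  (forall i, E i *m E i = - 1%:M) ->
  (forall i j, i != j -> E i *m E j = - (E j *m E i)) ->
  \sum_i E i *m (\sum_j E j *m u i j) =
  - (\sum_i u i i)
  + \sum_(i < n) \sum_(j < n | (i < j)%N) (E i *m E j) *m (u i j - u j i).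
Proof.
move=> sq anti.
transitivity (\sum_i \sum_j (E i *m E j) *m u i j).
  by apply: eq_bigr => i _; rewrite mulmx_sumr; apply: eq_bigr => j _; rewrite mulmxA.
have -> : \sum_i \sum_j (E i *m E j) *m u i j = \sum_(i < n) (- u i i
    + (\sum_(j < n | (i < j)%N) (E i *m E j) *m u i j
       - \sum_(j < n | (j < i)%N) (E j *m E i) *m u i j)).
  apply: eq_bigr => i _; rewrite (bigD1 i)//= sq mulNmx mul1mx; congr (_ + _).
  rewrite (bigID (fun j : 'I_n => (i < j)%N)) /=; congr (_ + _).
    by apply: eq_bigl => j; case: ltngtP => //; rewrite ?andbF// => ij; rewrite neq_ltn ij orbT.
  rewrite -sumrN; apply: eq_big => [j|j /andP[ji _]].
    by rewrite -leqNgt [RHS]ltn_neqAle.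
  by rewrite anti 1?eq_sym// mulNmx.
rewrite big_split /= sumrN; congr (_ + _); rewrite sumrB.
rewrite [X in _ - X](exchange_big_dep xpredT)//= -sumrB; apply: eq_bigr => i _.
by rewrite -sumrB; apply: eq_bigr => j _; rewrite mulmxBr.
Qed.

(** * The twisted connection, its curvature and the square of the Dirac operator *)

Section TwistedConnection.
Variables (R : realType) (n r m : nat) (M : topologicalType) (A : atlas R n M).
Variables (g : forall x : M, tangent A x -> tangent A x -> R).
Variables (nablaM : connection A (tangent_bundle g)).
Variables (F : vbundle R M r) (nablaF : connection A F) (P : frame_lift A F).
Variables (kappan : clifford_rep R n) (kappar : clifford_rep R r).
Hypotheses (manA : oriented_manifold A) (metg : riemannian_metric g).
Hypotheses (lcM : levi_civita nablaM) (bF : oriented_riemannian_bundle A F).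
Hypothesis metF : metric_connection g nablaF.
Variables (G : structure_group) (s : forall y, P y).
Hypothesis liftP : lifted_structure g G P.
Local Notation C := R[i].
Local Notation S := (spinor R n r m).
Local Notation op := 'M[C]_(2 ^ n./2 * (2 ^ r./2) ^ m).
Local Notation e := (fun y => frameT (s y)).
Local Notation f := (fun y => frameF (s y)).
Local Notation omega := (connection_form nablaM e).
Local Notation theta := (connection_form nablaF f).
Local Notation vop := (@vector_op R n r m kappan).
Local Notation top := (@twist_op R n r m kappar).
Local Notation nabla := (nabla_theta kappan kappar nablaM nablaF s).
Implicit Types (x y : M) (psi : M -> S) (X Y : vector_field A).

Let metM : metric_connection g nablaM := lcM.1.
Let secM := tangent_section_axioms manA metg.
Let secF := bundle_section_axioms manA bF.
Let onM y : orthonormal_basis (E := tangent_bundle g) (e y) :=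
  (frames_oriented liftP (s y)).1.1.
Let onF y : orthonormal_basis (f y) := (frames_oriented liftP (s y)).2.1.
Let smM y (sy : smooth_gauge y s) := (frames_smooth liftP sy).1.
Let smF y (sy : smooth_gauge y s) := (frames_smooth liftP sy).2.

Lemma lift_form_sumE k (L : {linear clifford C k -> op}) (w : 'I_k -> 'I_k -> R)
    (u : S) : (forall i j, w i j = - w j i) ->
  \sum_(i < k) \sum_(j < k | (i < j)%N) (w i j / 2)%:C *:
    (L (clifford_gen C i * clifford_gen C j) *m u) = L (lift_form w) *m u.
Proof.
move=> skw; rewrite /lift_form -(spin_liftE (@clifford_gen_rel C k)) => [|i j]; last first.
  by rewrite skw rmorphN.
rewrite linear_sum mulmx_suml; apply: eq_bigr => i _.
rewrite linear_sum mulmx_suml; apply: eq_bigr => j _.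
rewrite linearZ_LR rmorphM fmorphV rmorph_nat; exact: scalemxAl.
Qed.

(** The structure equation transported to operators. Asking [L] to respect commutators makes it
    apply to the twist action as well as to Clifford multiplication. *)
Lemma lift_form_curvature k (L : {linear clifford C k -> op})
    (a b c v w : 'I_k -> 'I_k -> R) :
  (forall p q, L p *m L q - L q *m L p = L (p * q - q * p)) ->
  (forall i j, v i j = - v j i) ->
  L (lift_form (fun i j => a i j - b i j - c i j
      + (\sum_p w i p * v p j - \sum_p v i p * w p j))) =
  L (lift_form a) - L (lift_form b) - L (lift_form c)
  + (L (lift_form v) *m L (lift_form w) - L (lift_form w) *m L (lift_form v)).
Proof.
move=> Lcomm skv; rewrite Lcomm lift_form_comm//.
rewrite (lift_formD (fun i j => a i j - b i j - c i j)) linearD; congr (_ + _).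
by rewrite (lift_formB (fun i j => a i j - b i j)) lift_formB !linearB.
Qed.

(** The ordered sums become lifts by skew-symmetry of the forms, which is obtained where the gauge
    is smooth; [gauge_open] extends this to a neighbourhood, as second derivatives require. *)
Lemma nabla_thetaE y (v : tangent A y) psi : smooth_gauge y s ->
  nabla v psi = spinor_derivative v psi + vop (lift_form (omega v)) *m psi y
    + top (lift_form (theta v)) *m psi y.
Proof.
move=> sy; rewrite /nabla_theta; congr (_ + _ + _).
  rewrite -lift_form_sumE => [|i j]; last first.
    by apply: (connection_form_skew secM metM) => // l; exact: smM.
  by apply: eq_bigr => i _; apply: eq_bigr => j _; rewrite clifford_act2E.
rewrite -lift_form_sumE => [|i j]; last first.
  by apply: (connection_form_skew secF metF) => // l; exact: smF.
by apply: eq_bigr => i _; apply: eq_bigr => j _; rewrite twist_act2E.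
Qed.

Section AtPoint.
Variable x : M.
Hypothesis sx : smooth_gauge x s.

Let omega_smooth X i j : smooth_field x X -> smooth_near A x (fun y => omega (X y) i j).
Proof. by move=> sX; apply: (connection_form_smooth secM metM) => //; exact: smM. Qed.

Let theta_smooth X i j : smooth_field x X -> smooth_near A x (fun y => theta (X y) i j).
Proof. by move=> sX; apply: (connection_form_smooth secF metF) => //; exact: smF. Qed.

Let near_nablaE X psi : \forall y \near x, spinor_derivative (X y) psi
  + vop (lift_form (omega (X y))) *m psi y + top (lift_form (theta (X y))) *m psi y
  = nabla (X y) psi.
Proof.
by have := gauge_open liftP sx; apply: filterS => y sy; rewrite nabla_thetaE.
Qed.

Lemma nabla_theta_smooth X psi : smooth_field x X -> smooth_spinor A x psi ->
  smooth_spinor A x (fun y => nabla (X y) psi).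
Proof.
move=> sX sp; apply: (smooth_spinor_eq manA (near_nablaE X psi)).
apply: smooth_spinorD => //; [apply: smooth_spinorD => //|].
- exact: smooth_spinor_field.
- by apply: smooth_spinor_lift => // i j; exact: omega_smooth.
- by apply: smooth_spinor_lift => // i j; exact: theta_smooth.
Qed.

Lemma nabla_theta_sum (I : Type) (q : seq I) (v : tangent A x) (psi : I -> M -> S) :
  (forall i, smooth_spinor A x (psi i)) ->
  nabla v (fun y => \sum_(i <- q) psi i y) = \sum_(i <- q) nabla v (psi i).
Proof.
move=> sp; rewrite nabla_thetaE// (spinor_derivative_sum manA)// !mulmx_sumr -!big_split.
by apply: eq_bigr => i _; rewrite nabla_thetaE.
Qed.

Let skewM (v : tangent A x) i j : omega v i j = - omega v j i.
Proof. by apply: (connection_form_skew secM metM) => // k; exact: smM. Qed.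

Let skewF (v : tangent A x) i j : theta v i j = - theta v j i.
Proof. by apply: (connection_form_skew secF metF) => // k; exact: smF. Qed.

(** In a gauge [e_k] acts by a constant matrix, so the covariant derivative of [e_k] arises solely
    from the commutator of that matrix with the lifted form of [TM]. *)
Lemma nabla_theta_vector (v : tangent A x) k psi : smooth_spinor A x psi ->
  nabla v (fun y => vop (clifford_gen C k) *m psi y) =
  vop (clifford_gen C k) *m nabla v psi
  + \sum_j (omega v k j)%:C *: (vop (clifford_gen C j) *m psi x).
Proof.
move=> sp; rewrite !nabla_thetaE// (spinor_derivative_mul manA)//.
have -> : \sum_j (omega v k j)%:C *: (vop (clifford_gen C j) *m psi x) =
    (vop (lift_form (omega v)) *m vop (clifford_gen C k)
    - vop (clifford_gen C k) *m vop (lift_form (omega v))) *m psi x.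
  rewrite -!vector_opM -linearB /lift_form.
  rewrite (spin_lift_comm_gen (@clifford_gen_rel C n)) => [|i j]; last first.
    by rewrite skewM rmorphN.
  rewrite linear_sum mulmx_suml; apply: eq_bigr => j _.
  by rewrite linearZ_LR; exact: scalemxAl.
exact/commute_connection_form/vector_twist_comm.
Qed.

Lemma nabla_thetaDl (u v : tangent A x) psi : nabla (u + v) psi = nabla u psi + nabla v psi.
Proof.
rewrite !nabla_thetaE// spinor_derivativeDl.
have -> : omega (u + v) = fun i j => omega u i j + omega v i j.
  apply/funext => i; apply/funext => j.
  by apply: (connection_formDl secM metM) => // k; exact: smM.
have -> : theta (u + v) = fun i j => theta u i j + theta v i j.
  apply/funext => i; apply/funext => j.
  by apply: (connection_formDl secF metF) => // k; exact: smF.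
rewrite !lift_formD [vop _]linearD [top _]linearD !mulmxDl.
by rewrite [RHS]addrACA; congr (_ + _); exact: addrACA.
Qed.

Lemma nabla_thetaZl a (v : tangent A x) psi : nabla (a *: v) psi = a%:C *: nabla v psi.
Proof.
rewrite !nabla_thetaE// spinor_derivativeZl.
have -> : omega (a *: v) = fun i j => a * omega v i j.
  apply/funext => i; apply/funext => j.
  by apply: (connection_formZl secM metM) => // k; exact: smM.
have -> : theta (a *: v) = fun i j => a * theta v i j.
  apply/funext => i; apply/funext => j.
  by apply: (connection_formZl secF metF) => // k; exact: smF.
rewrite !lift_formZ !linearZ_LR !scalerDr; congr (_ + _ + _); exact/esym/scalemxAl.
Qed.

Definition riemann X Y i j :=
  inner (v := tangent_bundle g) (curvature nablaM x X Y (fun y => e y i)) (e x j).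

Definition aux_curvature X Y k l := inner (curvature nablaF x X Y (fun y => f y k)) (f x l).

Lemma nabla_theta_curvature X Y psi :
  smooth_field x X -> smooth_field x Y -> smooth_spinor A x psi ->
  nabla (X x) (fun y => nabla (Y y) psi) - nabla (Y x) (fun y => nabla (X y) psi) =
  nabla (lie_bracket X Y x) psi + (vop (lift_form (riemann X Y)) *m psi x
  + top (lift_form (aux_curvature X Y)) *m psi x).
Proof.
move=> sX sY sp.
have nabla2E U V : smooth_field x U -> smooth_field x V ->
    nabla (U x) (fun y => nabla (V y) psi) =
    spinor_derivative (U x) (fun y => spinor_derivative (V y) psi)
    + (vop (lift_form (fun i j => U x (fun y => omega (V y) i j))) *m psi x
       + vop (lift_form (omega (V x))) *m spinor_derivative (U x) psi)
    + (top (lift_form (fun i j => U x (fun y => theta (V y) i j))) *m psi x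
       + top (lift_form (theta (V x))) *m spinor_derivative (U x) psi)
    + vop (lift_form (omega (U x))) *m (spinor_derivative (V x) psi
        + vop (lift_form (omega (V x))) *m psi x + top (lift_form (theta (V x))) *m psi x)
    + top (lift_form (theta (U x))) *m (spinor_derivative (V x) psi
        + vop (lift_form (omega (V x))) *m psi x + top (lift_form (theta (V x))) *m psi x).
  move=> sU sV; rewrite nabla_thetaE// nabla_thetaE//; congr (_ + _ + _).
  rewrite -(spinor_derivative_near_eq manA _ (near_nablaE V psi)).
  have s1 := smooth_spinor_field sV sp.
  have s2 : smooth_spinor A x (fun y => vop (lift_form (omega (V y))) *m psi y).
    by apply: smooth_spinor_lift => // i j; exact: omega_smooth.
  have s3 : smooth_spinor A x (fun y => top (lift_form (theta (V y))) *m psi y).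
    by apply: smooth_spinor_lift => // i j; exact: theta_smooth.
  rewrite (spinor_derivativeD _ (smooth_spinorD manA s1 s2) s3).
  rewrite (spinor_derivativeD _ s1 s2); congr (_ + _ + _).
    by apply: spinor_derivative_lift => // i j; exact: omega_smooth.
  by apply: spinor_derivative_lift => // i j; exact: theta_smooth.
have -> : vop (lift_form (riemann X Y)) =
    vop (lift_form (fun i j => X x (fun y => omega (Y y) i j)))
    - vop (lift_form (fun i j => Y x (fun y => omega (X y) i j)))
    - vop (lift_form (omega (lie_bracket X Y x)))
    + (vop (lift_form (omega (X x))) *m vop (lift_form (omega (Y x)))
       - vop (lift_form (omega (Y x))) *m vop (lift_form (omega (X x)))).
  rewrite -lift_form_curvature => [|p q|]; last exact: skewM; last first.
    by rewrite -!vector_opM linearB.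
  congr (vop (lift_form _)); apply/funext => i; apply/funext => j.
  by apply: (curvatureE secM metM) => // k; exact: smM.
have -> : top (lift_form (aux_curvature X Y)) =
    top (lift_form (fun i j => X x (fun y => theta (Y y) i j)))
    - top (lift_form (fun i j => Y x (fun y => theta (X y) i j)))
    - top (lift_form (theta (lie_bracket X Y x)))
    + (top (lift_form (theta (X x))) *m top (lift_form (theta (Y x)))
       - top (lift_form (theta (Y x))) *m top (lift_form (theta (X x)))).
  rewrite -lift_form_curvature => [|p q|]; last exact: skewF; last first.
    exact: twist_op_comm.
  congr (top (lift_form _)); apply/funext => i; apply/funext => j.
  by apply: (curvatureE secF metF) => // k; exact: smF.
rewrite !nabla2E// nabla_thetaE// (spinor_derivative_lie manA)//.
by apply: commute_connections; rewrite vector_twist_comm.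
Qed.

Let Rm i j := riemann (fun y => e y i) (fun y => e y j).
Let Th i j := aux_curvature (fun y => e y i) (fun y => e y j).

Let sfM i : smooth_field x (fun y => e y i). Proof. exact: (smM sx). Qed.

Let Rm_skewl i j k l : Rm i j k l = - Rm j i k l.
Proof. exact: (curvature_skewl manA secM metM onM (smM sx)). Qed.

Let Rm_skewr i j k l : Rm i j k l = - Rm i j l k.
Proof. exact: (curvature_skewr manA secM metM onM (smM sx)). Qed.

Let Th_skewr i j k l : Th i j k l = - Th i j l k.
Proof. exact: (curvature_skewr manA secF metF onF (smF sx)). Qed.

Let Rm_cyclic i j k l : Rm i j k l + Rm j k i l + Rm k i j l = 0.
Proof.
have iM := metric_inner metg.
by rewrite /Rm /riemann -!(innerDl iM) (bianchi manA lcM)// (inner0l iM).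
Qed.

Lemma lie_bracket_frame i j : lie_bracket (fun y => e y i) (fun y => e y j) x =
  \sum_k (omega (e x i) j k - omega (e x j) i k) *: e x k.
Proof.
have <- := lcM.2 x _ _ (sfM i) (sfM j).
rewrite (connection_frameE nablaM onM (e x i) j) (connection_frameE nablaM onM (e x j) i).
by rewrite -sumrB; apply: eq_bigr => k _; rewrite scalerBl.
Qed.

Lemma nabla_theta_comb (I : Type) (q : seq I) (a : I -> R) (v : I -> tangent A x) psi :
  nabla (\sum_(i <- q) a i *: v i) psi = \sum_(i <- q) (a i)%:C *: nabla (v i) psi.
Proof.
elim: q => [|i q IHq].
  by rewrite !big_nil -(scale0r (0 : tangent A x)) (nabla_thetaZl)// scale0r.
by rewrite !big_cons (nabla_thetaDl)// (nabla_thetaZl)// IHq.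
Qed.

Let sqM i : vop (clifford_gen C i) *m vop (clifford_gen C i) = - 1%:M.
Proof.
rewrite -vector_opM -scaleN1r scalemx1.
have : 2 *: (clifford_gen C i * clifford_gen C i) = 2 *: (- 1 : clifford C n).
  by rewrite scaler_nat mulr2n clifford_gen_rel eqxx mulr1 scalerN.
move=> /scalerI ->; last by rewrite pnatr_eq0.
by rewrite -scaleN1r vector_op_scalar.
Qed.

Let antiM i j : i != j -> vop (clifford_gen C i) *m vop (clifford_gen C j) =
  - (vop (clifford_gen C j) *m vop (clifford_gen C i)).
Proof.
by move=> ij; rewrite -!vector_opM (clifford_swap_neq (@clifford_gen_rel C n) ij) linearN.
Qed.

Let riemann_contraction (u : S) :
  \sum_(i < n) \sum_(j < n | (i < j)%N)
    (vop (clifford_gen C i) *m vop (clifford_gen C j)) *m (vop (lift_form (Rm i j)) *m u) =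
  (scalar_curvature nablaM e x / 4)%:C *: u.
Proof.
transitivity (vop (\sum_(i < n) \sum_(j < n | (i < j)%N)
    clifford_gen C i * clifford_gen C j * lift_form (Rm i j)) *m u).
  rewrite linear_sum mulmx_suml; apply: eq_bigr => i _.
  rewrite linear_sum mulmx_suml; apply: eq_bigr => j _.
  by rewrite mulmxA -!vector_opM.
have psym := pair_symmetry Rm_skewl Rm_skewr Rm_cyclic.
rewrite /lift_form (@curvature_contraction C _ n _ (@clifford_gen_rel C n)
  (fun i j k l => (Rm i j k l)%:C)) => [|i j k l|i j k l|i l]; last 3 first.
- by rewrite Rm_skewl rmorphN.
- by rewrite -!rmorphD Rm_cyclic.
(* Symmetry of the Ricci tensor: pair symmetry exchanges the two index pairs, then each pair is
   reversed. *)
- apply: eq_bigr => j _; rewrite psym; congr (_%:C).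
  by rewrite Rm_skewl Rm_skewr opprK.
rewrite vector_op_scalar mul_scalar_mx; congr (_ *: _).
rewrite mulrC rmorphM fmorphV rmorph_nat rmorph_sum; congr (_ / _).
by apply: eq_bigr => i _; rewrite rmorph_sum.
Qed.

Let twist_contraction (Psi : gauge_field m P) :
  \sum_(i < n) \sum_(j < n | (i < j)%N)
    (vop (clifford_gen C i) *m vop (clifford_gen C j))
      *m (top (lift_form (Th i j)) *m Psi s x) =
  2^-1 *: twisted_curvature kappan kappar nablaF Psi s x.
Proof.
rewrite /twisted_curvature.
under [in RHS]eq_bigr => k _ do rewrite exchange_big.
rewrite [in RHS]exchange_big scaler_sumr; apply: eq_bigr => i _ /=.
under [in RHS]eq_bigr => k _ do rewrite exchange_big.
rewrite [in RHS]exchange_big scaler_sumr; apply: eq_bigr => j _ /=.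
(* Written over [k < l], the lifted form carries the factor 1/2 that appears in the final
   formula. *)
rewrite -lift_form_sumE => [|k l]; last exact: Th_skewr.
rewrite mulmx_sumr scaler_sumr; apply: eq_bigr => k _.
rewrite mulmx_sumr scaler_sumr; apply: eq_bigr => l _.
rewrite -scalemxAr clifford_act2E twist_act2E vector_opM scalerA; congr (_ *: _).
by rewrite rmorphM fmorphV rmorph_nat mulrC.
Qed.

Lemma twisted_dirac_square (Psi : gauge_field m P) : smooth_spinor A x (Psi s) ->
  let D := twisted_dirac kappan kappar nablaM nablaF (P := P) (m := m) in
  D (D Psi) s x = connection_laplacian kappan kappar nablaM nablaF Psi s x
    + (scalar_curvature nablaM e x / 4)%:C *: Psi s x
    + 2^-1 *: twisted_curvature kappan kappar nablaF Psi s x.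
Proof.
set psi := Psi s => sp D.
pose a i j := nabla (e x i) (fun y => nabla (e y j) psi).
pose b i := nabla (e x i) psi.
(* The coefficient of [e_j] in the derivative along [e_i] of [\sum_k e_k b_k]: differentiating [e_k]
   itself contributes its component [omega (e x i) k j] along [e_j]. *)
pose u i j := a i j + \sum_k (omega (e x i) k j)%:C *: b k.
have sn j : smooth_spinor A x (fun y => nabla (e y j) psi) by exact: nabla_theta_smooth.
have -> : D (D Psi) s x =
    \sum_i vop (clifford_gen C i) *m (\sum_j vop (clifford_gen C j) *m u i j).
  rewrite /D /twisted_dirac -/psi; apply: eq_bigr => i _; rewrite clifford_act1E.
  congr (_ *m _).
  transitivity (nabla (e x i)
      (fun y => \sum_j vop (clifford_gen C j) *m nabla (e y j) psi)).
    congr (nabla_theta _ _ _ _ _ _ _); apply/funext => y.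
    by apply: eq_bigr => j _; rewrite clifford_act1E.
  rewrite nabla_theta_sum => [|j]; last exact: smooth_spinor_mul.
  under eq_bigr => j _ do rewrite nabla_theta_vector// -/(a i j) -/(b j).
  under [RHS]eq_bigr => j _ do rewrite mulmxDr.
  rewrite !big_split; congr (_ + _); rewrite exchange_big; apply: eq_bigr => j _ /=.
  by rewrite mulmx_sumr; apply: eq_bigr => k _; rewrite scalemxAr.
rewrite (dirac_square _ sqM antiM) -addrA; congr (_ + _).
  (* On the diagonal, [\sum_i omega (e x i) k i] is the divergence of [e_k]. *)
  rewrite /connection_laplacian -/psi -opprD; congr (- _).
  rewrite big_split; congr (_ + _); rewrite exchange_big; apply: eq_bigr => i _ /=.
  by rewrite -scaler_suml -rmorph_sum.
rewrite -riemann_contraction -twist_contraction -big_split; apply: eq_bigr => i _ /=.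
rewrite -big_split; apply: eq_bigr => j _ /=; rewrite -mulmxDr; congr (_ *m _).
have := nabla_theta_curvature (sfM i) (sfM j) sp.
rewrite lie_bracket_frame nabla_theta_comb => aE.
(* The bracket contributes [b k] with coefficient [omega (e x i) j k - omega (e x j) i k], and
   [u i j - u j i] the same with the last two indices exchanged; by skew-symmetry they cancel. *)
rewrite /u opprD addrACA [X in X + _]aE -sumrB addrAC -big_split big1 ?add0r// => k _.
transitivity ((omega (e x i) j k - omega (e x j) i k
    + (omega (e x i) k j - omega (e x j) k i))%:C *: b k).
  by rewrite [in RHS]rmorphD scalerDl; congr (_ + _); rewrite rmorphB scalerBl.
rewrite [omega (e x i) k j]skewM [omega (e x j) k i]skewM.
by rewrite opprK addrACA addrN add0r addNr scale0r.
Qed.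

End AtPoint.
End TwistedConnection.

Theorem theorem3p4 (R : realType) (n r m : nat)
    (M : topologicalType) (A : atlas R n M)
    (g : forall x : M, tangent A x -> tangent A x -> R)
    (nablaM : connection A (tangent_bundle g))
    (F : vbundle R M r) (nablaF : connection A F)
    (P0 P : frame_lift A F)
    (kappan : clifford_rep R n) (kappar : clifford_rep R r)
    (phi : forall x : M, P x -> spinor R n r m) :
  (2 <= r)%N ->
  oriented_manifold A -> riemannian_metric g -> levi_civita nablaM ->
  oriented_riemannian_bundle A F -> metric_connection g nablaF ->
  lifted_structure g SpinR P0 -> globally_defined g m P0 P ->
  spinor_rep kappan -> spinor_rep kappar ->
  spinor_section kappan kappar phi ->
  let Phi := representatives phi in
  let D := twisted_dirac kappan kappar nablaM nablaF (P := P) (m := m) in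
  forall (x : M) (s : forall y : M, P y), smooth_gauge x s ->
    D (D Phi) s x =
      connection_laplacian kappan kappar nablaM nablaF Phi s x
      + (scalar_curvature nablaM (fun y => frameT (s y)) x / 4)%:C%C *: Phi s x
      + 2^-1 *: twisted_curvature kappan kappar nablaF Phi s x.
Proof.
move=> _ manA metg lcM bF metF liftP0 glob _ _ sphi Phi D x s sx.
(* In each of the three cases [P] is a lifted structure for some group, and the local formula holds
   for all of them alike. *)
have [G liftP] : exists G, lifted_structure g G P.
  case: glob => [[_ ->]|liftP|[_ liftP]]; [by exists SpinR|by exists SpinSpin|].
  by exists SpinSO.
apply: (twisted_dirac_square _ _ manA metg lcM bF metF liftP sx).
exact: (section_smooth sphi sx).
Qed.
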